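(* Let $n\ge1$, let $X_0\sim\mathcal N(\mu_0,\sigma_0^2)$ and, independently, $X_1,\dots,X_n$ i.i.d. $\mathcal N(\mu,\sigma^2)$, with $\mu_0,\mu\in\mathbb R$, $\sigma_0,\sigma\in(0,\infty)$; put $\delta:=(\mu-\mu_0)/\sigma_0$, $\rho:=\sigma/\sigma_0$, and $R_0:=1+\sum_{i=1}^n\mathbf 1_{\{X_i\le X_0\}}$ (the law of $R_0$ depends on the four parameters only through $(\rho,\delta)$). For $1\le k\le n+1$ let $$p_{\rho,\delta}(k):=\binom{n}{k-1}\frac{B\big(a_{\rho,\delta}+k-1,\;b_{\rho,\delta}+n+1-k\big)}{B(a_{\rho,\delta},b_{\rho,\delta})},$$ with $a_{\rho,\delta},b_{\rho,\delta}>0$ as defined in the context and $B$ the beta function. Then for every $1\le k\le n+1$: 1. $\lim_{\rho\to0^+}\left|\Pr(R_0=k)-p_{\rho,\delta}(k)\right|=0$; 2. $\lim_{\rho\to\infty}\left|\Pr(R_0=k)-p_{\rho,\delta}(k)\right|=0$; 3. $\lim_{|\delta|\to\infty}\left|\Pr(R_0=k)-p_{\rho,\delta}(k)\right|=0$; 4. $\lim_{\rho,|\delta|\to\infty}\left|\Pr(R_0=k)-p_{\rho,\delta}(k)\right|=0$, where $\delta/\rho$ is held fixed in taking this limit.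
   Context: $\Phi$ is the standard normal CDF. $B(\alpha,\beta):=\int_0^1y^{\alpha-1}(1-y)^{\beta-1}dy$. Let $Z_{\rho,\delta}:=\Phi((X_0-\mu)/\sigma)$, which has CDF $y\mapsto\Phi(\delta+\rho\,\Phi^{-1}(y))$ on $(0,1)$. With $p:=\Phi(-\delta/\sqrt{\rho^2+1})$ (the mean of $Z_{\rho,\delta}$), so $1-p=\Phi(\delta/\sqrt{\rho^2+1})$, define $$a_{\rho,\delta}:=\frac{p\,[\,p(1-p)-\mathrm{Var}(Z_{\rho,\delta})\,]}{\mathrm{Var}(Z_{\rho,\delta})},\qquad b_{\rho,\delta}:=\frac{(1-p)\,[\,p(1-p)-\mathrm{Var}(Z_{\rho,\delta})\,]}{\mathrm{Var}(Z_{\rho,\delta})}.$$ These are positive since $0<\mathrm{Var}(Z_{\rho,\delta})<p(1-p)$. $n$ and $k$ are fixed in all limits; when only one of $\rho,\delta$ is sent to a limit, the other is held fixed. *)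

(* Defs.v *)
From mathcomp Require Import all_boot all_order all_algebra.
From mathcomp Require Import all_classical all_reals all_analysis.

Set Implicit Arguments.
Unset Strict Implicit.
Unset Printing Implicit Defensive.

Import Order.TTheory GRing.Theory Num.Theory.
Import numFieldNormedType.Exports.

Local Open Scope classical_set_scope.
Local Open Scope ring_scope.

Definition mutually_independent (R : realType) d (T : measurableType d)
    (P : probability T R) (I : finType) (X : I -> {RV P >-> R}) : Prop :=
  forall (J : {set I}) (A : I -> set R), (forall i, measurable (A i)) ->
    P (\bigcap_(i in [set` J]) (X i @^-1` A i)) =
    (\prod_(i in J) P (X i @^-1` A i))%E.

(* The second parameter of [normal_prob] is the standard deviation. *)
Definition normally_distributed (R : realType) d (T : measurableType d)
    (P : probability T R) (X : {RV P >-> R}) (m s : R) : Prop :=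
  forall A : set R, measurable A -> distribution P X A = normal_prob m s A.

(* The index [ord0] carries X_0; X_1, ..., X_n are the indices [lift ord0 i]
   for [i : 'I_n]. *)
Record normal_sample (R : realType) (n : nat) := NormalSample {
  ns_display : measure_display;
  ns_space : measurableType ns_display;
  ns_prob : probability ns_space R;
  ns_rv : 'I_n.+1 -> {RV ns_prob >-> R};
  ns_mu0 : R;
  ns_sigma0 : R;
  ns_mu : R;
  ns_sigma : R;
  ns_sigma0_gt0 : 0 < ns_sigma0;
  ns_sigma_gt0 : 0 < ns_sigma;
  ns_law0 : normally_distributed (ns_rv ord0) ns_mu0 ns_sigma0;
  ns_law : forall i : 'I_n,
    normally_distributed (ns_rv (lift ord0 i)) ns_mu ns_sigma;
  ns_indep : mutually_independent ns_rv
}.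

Lemma independent_family_exists (R : realType) n
    (mu : 'I_n -> probability (measurableTypeR R) R) :
  exists d (T : measurableType d) (P : probability T R) (X : 'I_n -> {RV P >-> R}),
   forall A : 'I_n -> set R, (forall i, measurable (A i)) ->
    P (\bigcap_i (X i @^-1` A i)) = (\prod_i mu i (A i))%E.
Proof.
elim: n mu => [|n IH] mu.
  exists _, unit, (dirac tt : probability unit R).
  have X0 : 'I_0 -> {RV (dirac tt : probability unit R) >-> R} by case.
  exists X0 => A mA.
  have -> : \bigcap_i (X0 i @^-1` A i) = setT.
    by apply/seteqP; split => // x _ [].
  by rewrite big_ord0 probability_setT.
have [d [T [P [X HX]]]] := IH (fun i => mu (lift ord0 i)).
pose Q : probability (T * measurableTypeR R)%type R := (P \x mu ord0)%E.
have mf i : measurable_fun setT (X i \o fst : (T * measurableTypeR R)%type -> R).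
  exact: measurableT_comp.
have ms : measurable_fun setT (snd : (T * measurableTypeR R)%type -> R).
  exact: measurable_snd.
pose mk (f : (T * measurableTypeR R)%type -> R)
  (mf : measurable_fun setT f) : {RV Q >-> R} :=
  mfun_Sub (mem_set mf).
pose Y (i : 'I_n.+1) : {RV Q >-> R} :=
  if unlift ord0 i is Some j then mk _ (mf j) else mk _ ms.
exists _, _, Q, Y => A mA.
have -> : \bigcap_i (Y i @^-1` A i) =
  (\bigcap_i (X i @^-1` A (lift ord0 i))) `*` A ord0.
  apply/seteqP; split => [x Hx|x [/= H1 H2] i _].
    split; last by have := Hx ord0 I; rewrite /Y unlift_none.
    by move=> i _; have := Hx (lift ord0 i) I; rewrite /Y liftK.
  rewrite /Y; case: unliftP => [j ->|->] //=; exact: H1.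
have mX : measurable (\bigcap_i (X i @^-1` A (lift ord0 i))).
  apply: fin_bigcap_measurable => // i _.
  by rewrite -[_ @^-1` _]setTI; exact: measurable_funP.
rewrite [LHS](product_measure1E P (mu ord0) mX (mA _)).
by rewrite big_ord_recl muleC -(HX (fun i => A (lift ord0 i))).
Qed.

Lemma normal_sample_exists (R : realType) n (m0 s0 m s : R) : 0 < s0 -> 0 < s ->
  exists M : normal_sample R n,
    [/\ ns_mu0 M = m0, ns_sigma0 M = s0, ns_mu M = m & ns_sigma M = s].
Proof.
move=> s0_gt0 s_gt0.
pose N (a b : R) : probability (measurableTypeR R) R := normal_prob a b.
pose mu (i : 'I_n.+1) : probability (measurableTypeR R) R :=
  if i == ord0 then N m0 s0 else N m s.
have [d [T [P [X HX]]]] := @independent_family_exists _ _ mu.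
have law i A : measurable A -> P (X i @^-1` A) = mu i A.
  move=> mA; have /= := HX (fun j => if j == i then A else setT).
  rewrite (bigD1 i)//= eqxx big1 ?mule1; last first.
    by move=> j /negbTE ->; rewrite probability_setT.
  move=> <-; last by move=> j; case: ifP.
  congr (P _); apply/seteqP; split => [x Ax j _ /=|x /(_ i I) /=].
    by case: eqVneq => [->|].
  by rewrite eqxx.
have l0 : normally_distributed (X ord0) m0 s0.
  by move=> A mA; rewrite /distribution /pushforward law// /mu eqxx.
have l1 i : normally_distributed (X (lift ord0 i)) m s.
  by move=> A mA; rewrite /distribution /pushforward law// /mu.
have ind : mutually_independent X.
  move=> J A mA; have /= := HX (fun j => if j \in J then A j else setT).
  rewrite (bigID (mem J))/= [X in (_ * X)%E]big1 ?mule1; last first.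
    by move=> j /negbTE ->; rewrite probability_setT.
  move=> H; rewrite (_ : \bigcap_(i in _) _ =
     \bigcap_i (X i @^-1` (if i \in J then A i else setT))).
    rewrite H; last by move=> j; case: ifP.
    by apply: eq_bigr => j jJ; rewrite jJ law.
  apply/seteqP; split => [x Ax j _ /=|x Ax j /= jJ].
    by case: ifPn => // jJ; exact: Ax.
  by have /= := Ax j I; rewrite jJ.
by exists (NormalSample s0_gt0 s_gt0 l0 l1 ind).
Qed.

Section Sample.
Variables (R : realType) (n : nat) (M : normal_sample R n).

Definition ns_delta : R := (ns_mu M - ns_mu0 M) / ns_sigma0 M.

Definition ns_rho : R := ns_sigma M / ns_sigma0 M.

Definition ns_rank (w : ns_space M) : nat :=
  (1 + \sum_(i < n) (ns_rv M (lift ord0 i) w <= ns_rv M ord0 w)%R)%N.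

Definition ns_rank_prob (k : nat) : R :=
  fine (ns_prob M [set w | ns_rank w = k]).

End Sample.

Definition Phi (R : realType) (x : R) : R := fine (normal_prob 0 1 `]-oo, x]).

(* The library's [beta_fun] only takes natural number arguments. *)
Definition Beta (R : realType) (a b : R) : R :=
  \int[lebesgue_measure]_(y in `[0, 1]) (y `^ (a - 1) * (1 - y) `^ (b - 1)).

Section BetaBinomial.
Variables (R : realType) (n : nat) (M : normal_sample R n).

Definition Z (w : ns_space M) : R :=
  Phi ((ns_rv M ord0 w - ns_mu M) / ns_sigma M).

Definition varZ : R := fine ('V_(ns_prob M)[Z])%E.

Definition meanZ : R := Phi (- ns_delta M / Num.sqrt (ns_rho M ^+ 2 + 1)).

Definition beta_a : R := meanZ * (meanZ * (1 - meanZ) - varZ) / varZ.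

Definition beta_b : R := (1 - meanZ) * (meanZ * (1 - meanZ) - varZ) / varZ.

Definition beta_binomial_prob (k : nat) : R :=
  'C(n, k - 1)%:R *
  (Beta (beta_a + k%:R - 1) (beta_b + n%:R + 1 - k%:R) / Beta beta_a beta_b).

End BetaBinomial.

(* The filter for the limit |x| -> +oo. *)
Definition norm_pinfty_nbhs (R : realType) : set_system R :=
  [set A | \forall r \near +oo, forall x, r < `|x| -> A x].
Arguments norm_pinfty_nbhs R : clear implicits.

Global Instance norm_pinfty_nbhs_filter (R : realType) :
  ProperFilter (norm_pinfty_nbhs R).
Proof.
split.
  rewrite /norm_pinfty_nbhs /= => H; near +oo_R => r.
  have r0 : 0 <= r by near: r; exact: nbhs_pinfty_ge.
  have : forall x : R, r < `|x| -> set0 x by near: r.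
  by move=> /(_ (r + 1)); apply; rewrite ger0_norm ?addr_ge0// ltrDl.
split=> [|A B|A B AB]; rewrite /norm_pinfty_nbhs /=.
- by near=> r.
- by apply: filterS2 => r Ar Br x rx; split; [exact: Ar|exact: Br].
- by apply: filterS => r Ar x rx; exact/AB/Ar.
Unshelve. all: by end_near. Qed.

(* Main.v *)
Require Import Defs.
From mathcomp Require Import all_boot all_order all_algebra.
From mathcomp Require Import all_classical all_reals all_analysis.
From mathcomp Require Import measurable_realfun.
From mathcomp Require Import ring lra.
Set Implicit Arguments.
Unset Strict Implicit.
Unset Printing Implicit Defensive.

Import Order.TTheory GRing.Theory Num.Theory.
Import numFieldNormedType.Exports.
Local Open Scope classical_set_scope.
Local Open Scope ring_scope.

(** Write [z] for a standard normal variable and [Z = Phi ((z - delta) / rho)],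
    which has the law of [Phi ((X_0 - mu) / sigma)].  Given [X_0], the events
    [X_i <= X_0] are independent of probability [Z], so that
    [P(R_0 = k) = 'C(n, k-1) E[Z^i (1 - Z)^j]] with [i = k - 1], [j = n - i].
    For the same [i], [j] the beta-binomial weight is
    ['C(n, k-1) E[W^i (1 - W)^j]] with [W] of law Beta(a, b), and [a], [b] are
    chosen so that [W] has the mean [p] and the variance [V] of [Z].  Hence [Z]
    and [W] also share [q = E[Z (1 - Z)] = p (1 - p) - V].

    The two expectations are therefore close whenever [V] or [q] is small,
    whatever the two laws are:
    - [u^i (1 - u)^j] is [n]-Lipschitz on [0, 1], so each expectation is within
      [O(sqrt V)] of its value at [p] ([bernstein_compare_variance]);
    - [u^i (1 - u)^j] differs from its chord by at most [n u (1 - u)], and the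
      chord has the same expectation under both laws, so the gap is [O(q)]
      ([bernstein_compare_chord]).

    In the limits, [q] tends to 0 when [rho] does, because [Z] then
    concentrates at 0 and 1 ([zmean_q_cvg0]); [V] tends to 0 when [rho] tends to
    infinity, uniformly in [delta], because [Z] then concentrates at
    [Phi (- delta / rho)] ([zvar_cvg_pinfty], which covers both a fixed [delta]
    and a fixed [delta / rho]); and [V <= p (1 - p)] tends to 0 when [|delta|]
    tends to infinity ([zvar_cvg_norm_pinfty]).

    Three computations make this rigorous: the moments of the beta law with real
    parameters ([beta_integralX], [beta_integralX1X]); the identity
    [E Z = Phi (- delta / sqrt (rho^2 + 1))], which says that [Z] has the mean
    prescribed in the definition of [a] and [b] ([Rintegral_Phi_mean]); and the
    law of the rank, obtained from the product rule by a monotone class argument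
    and Fubini ([conditioning_on_head], [count_le_binomial]). *)

(** * Averages of polynomials on the unit interval *)

(** What the comparison needs to know of a probability law on [0, 1]: the
    positive normalized linear form it induces on polynomials.  The score and
    the beta law live on different spaces, and this form treats them alike. *)
Definition moment_functional (R : realType) (L : {poly R} -> R) : Prop :=
  [/\ forall p q, L (p + q) = L p + L q,
      forall c p, L (c *: p) = c * L p,
      L 1 = 1
    & forall p, (forall y, 0 <= y <= 1 -> 0 <= p.[y]) -> 0 <= L p].

Section MomentFunctional.
Variables (R : realType) (L : {poly R} -> R).
Hypothesis HL : moment_functional L.

Lemma moment_functionalB p q : L (p - q) = L p - L q.
Proof. by case: HL => LD LZ _ _; rewrite LD -scaleN1r LZ mulN1r. Qed.

Lemma moment_functionalC c : L c%:P = c.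
Proof. by case: HL => _ LZ L1 _; rewrite -[c%:P]mulr1 mul_polyC LZ L1 mulr1. Qed.

Lemma moment_functional_le p q : (forall y, 0 <= y <= 1 -> p.[y] <= q.[y]) ->
  L p <= L q.
Proof.
case: HL => _ _ _ Lge0 pq; rewrite -subr_ge0 -moment_functionalB; apply: Lge0.
by move=> y y01; rewrite hornerD hornerN subr_ge0 pq.
Qed.

Lemma moment_functional_norm p q :
  (forall y, 0 <= y <= 1 -> `|p.[y]| <= q.[y]) -> `|L p| <= L q.
Proof.
case: (HL) => _ LZ _ _ pq; rewrite ler_norml; apply/andP; split.
  rewrite -mulN1r -LZ; apply: moment_functional_le => y /pq.
  by rewrite ler_norml hornerZ mulN1r => /andP[].
by apply: moment_functional_le => y /pq; rewrite ler_norml => /andP[].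
Qed.

Lemma moment_functional_mean01 : 0 <= L 'X <= 1.
Proof.
case: (HL) => _ _ _ Lge0; apply/andP; split.
  by apply: Lge0 => y; rewrite hornerX => /andP[].
rewrite -[leRHS]moment_functionalC; apply: moment_functional_le => y.
by rewrite hornerX hornerC => /andP[].
Qed.

(** Bias-variance decomposition; the variance is [p (1 - p) - q], since
    [u^2 = u - u (1 - u)]. *)
Lemma moment_functional_variance (c : R) :
  L (('X - c%:P) ^+ 2) = L 'X * (1 - L 'X) - L ('X * (1 - 'X)) + (L 'X - c) ^+ 2.
Proof.
have -> : ('X - c%:P) ^+ 2 =
    (1 - 2 * c) *: 'X - 'X * (1 - 'X) + (c ^+ 2)%:P :> {poly R}.
  by rewrite -mul_polyC rmorphB rmorphM rmorphXn /= rmorph1 rmorph_nat; ring.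
case: (HL) => LD LZ _ _.
by rewrite LD moment_functionalB LZ moment_functionalC; ring.
Qed.

End MomentFunctional.

Section BernsteinBounds.
Variable R : realType.
Implicit Types (x y : R) (i j : nat).

Lemma expr_itv01 y i : 0 <= y <= 1 -> 0 <= y ^+ i <= 1.
Proof. by move=> /andP[y0 y1]; rewrite exprn_ge0 // exprn_ile1. Qed.

Lemma bernoulli_sub1X y i : 0 <= y <= 1 -> 1 - y ^+ i <= i%:R * (1 - y).
Proof.
move=> y01; elim: i => [|i IH]; first by rewrite expr0 mul0r subrr.
have /andP[h0 h1] := expr_itv01 i y01; case/andP: y01 => y0 y1.
rewrite exprS -natr1; nra.
Qed.

(** For [j = 0] (resp. [i = 0]) the polynomial agrees with its chord [u]
    (resp. [1 - u]) at both ends and Bernoulli's inequality bounds the gap;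
    otherwise it vanishes at both ends and is at most [u (1 - u)]. *)
Lemma bernstein_chord i j y : (0 < i + j)%N -> 0 <= y <= 1 ->
  `|y ^+ i * (1 - y) ^+ j - ((j == 0)%N%:R * y + (i == 0)%N%:R * (1 - y))|
    <= (i + j)%:R * (y * (1 - y)).
Proof.
have aux k (z : R) : 0 <= z <= 1 -> `|z ^+ k.+1 - z| <= k.+1%:R * (z * (1 - z)).
  move=> z01; have /andP[h0 h1] := expr_itv01 k z01.
  have hB := bernoulli_sub1X k z01; case/andP: z01 => z0 z1.
  have := ler0n R k.
  by rewrite exprS -natr1 ler_norml; nra.
case: i j => [|i] [|j]//= _ y01.
- rewrite expr0 mul1r mul0r add0r mul1r add0n.
  have y'01 : 0 <= 1 - y <= 1 by lra.
  by have := aux j _ y'01; rewrite subKr [y * _]mulrC.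
- by rewrite expr0 mulr1 mul0r addr0 mul1r addn0; exact: aux.
have y'01 : 0 <= 1 - y <= 1 by lra.
have /andP[h0 h1] := expr_itv01 i y01.
have /andP[k0 k1] := expr_itv01 j y'01.
case/andP: y01 => y0 y1.
rewrite !mul0r addr0 subr0 !exprS ger0_norm; last first.
  by rewrite !mulr_ge0 // subr_ge0.
rewrite mulrACA mulrC ler_wpM2r ?mulr_ge0 ?subr_ge0//.
by rewrite (@le_trans _ _ 1)// ?ler1n// mulr_ile1.
Qed.

Lemma expr_lipschitz01 i x y : 0 <= x <= 1 -> 0 <= y <= 1 ->
  `|x ^+ i - y ^+ i| <= i%:R * `|x - y|.
Proof.
move=> x01 y01; elim: i => [|i IH]; first by rewrite !expr0 subrr normr0 mul0r.
have /andP[h0 h1] := expr_itv01 i y01.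
have -> : x ^+ i.+1 - y ^+ i.+1 = x * (x ^+ i - y ^+ i) + (x - y) * y ^+ i.
  by rewrite !exprS; ring.
rewrite -natr1 [leRHS]mulrDl mul1r (le_trans (ler_normD _ _))// lerD//.
  case/andP: x01 => x0 x1.
  by rewrite normrM ger0_norm// (le_trans _ IH)// ler_piMl.
by rewrite normrM (ger0_norm h0) ler_piMr.
Qed.

Lemma bernstein_lipschitz i j x y : 0 <= x <= 1 -> 0 <= y <= 1 ->
  `|x ^+ i * (1 - x) ^+ j - y ^+ i * (1 - y) ^+ j| <= (i + j)%:R * `|x - y|.
Proof.
move=> x01 y01.
have x'01 : 0 <= 1 - x <= 1 by lra.
have y'01 : 0 <= 1 - y <= 1 by lra.
have -> : x ^+ i * (1 - x) ^+ j - y ^+ i * (1 - y) ^+ j =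
  x ^+ i * ((1 - x) ^+ j - (1 - y) ^+ j) + (x ^+ i - y ^+ i) * (1 - y) ^+ j by ring.
have /andP[h0 h1] := expr_itv01 i x01.
have /andP[k0 k1] := expr_itv01 j y'01.
rewrite natrD [leRHS]mulrDl (le_trans (ler_normD _ _))// addrC lerD//.
  rewrite normrM (ger0_norm k0) (le_trans _ (expr_lipschitz01 i x01 y01))//.
  by rewrite ler_piMr.
rewrite normrM (ger0_norm h0).
have := expr_lipschitz01 j x'01 y'01.
rewrite (_ : 1 - x - (1 - y) = y - x); last by ring.
by rewrite (distrC y) => h; rewrite (le_trans _ h)// ler_piMl.
Qed.

End BernsteinBounds.

Definition bernstein (R : realType) i j : {poly R} := 'X ^+ i * (1 - 'X) ^+ j.
Arguments bernstein {R} i j.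

Lemma bernsteinE (R : realType) i j (y : R) : (bernstein i j).[y] = y ^+ i * (1 - y) ^+ j.
Proof. by rewrite /bernstein !(hornerE, horner_exp). Qed.

Section Comparison.
Variables (R : realType) (L L' : {poly R} -> R).
Hypotheses (HL : moment_functional L) (HL' : moment_functional L').
Hypothesis same_mean : L 'X = L' 'X.
Hypothesis same_q : L ('X * (1 - 'X)) = L' ('X * (1 - 'X)).

(** The function [l] that both forms integrate alike is subtracted first; only
    the remainder, dominated by [g], is estimated. *)
Lemma moment_functional_compare (f l g : {poly R}) : L l = L' l -> L g = L' g ->
  (forall y, 0 <= y <= 1 -> `|f.[y] - l.[y]| <= g.[y]) ->
  `|L f - L' f| <= 2 * L g.
Proof.
move=> Ll Lg fg.
have -> : L f - L' f = L (f - l) - L' (f - l).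
  by rewrite !moment_functionalB// Ll; ring.
have fg' y : 0 <= y <= 1 -> `|(f - l).[y]| <= g.[y].
  by move=> /fg; rewrite hornerD hornerN.
rewrite (le_trans (ler_normB _ _))// mulr2n mulrDl mul1r lerD//.
  exact: moment_functional_norm.
by rewrite Lg; exact: moment_functional_norm.
Qed.

Lemma bernstein_compare_chord i j : (0 < i + j)%N ->
  `|L (bernstein i j) - L' (bernstein i j)| <=
  2 * ((i + j)%:R * L ('X * (1 - 'X))).
Proof.
move=> ij; case: (HL) (HL') => LD LZ L1 _ [LD' LZ' L1' _].
rewrite -LZ.
apply: (@moment_functional_compare _
  ((j == 0)%N%:R *: 'X + (i == 0)%N%:R *: (1 - 'X)) _).
- rewrite LD LD' !LZ !LZ' !moment_functionalB// same_mean.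
  by rewrite L1 L1'.
- by rewrite LZ LZ' same_q.
move=> y y01; rewrite bernsteinE !hornerE.
by have := bernstein_chord ij y01; rewrite [leRHS]mulrA.
Qed.

(** The inequality [|u - p| <= e + (u - p)^2 / e] turns the Lipschitz bound into
    a polynomial one, to which the forms apply; [e = sqrt V] balances the two
    terms. *)
Lemma bernstein_compare_variance i j :
  `|L (bernstein i j) - L' (bernstein i j)| <=
  4 * ((i + j)%:R * Num.sqrt (L 'X * (1 - L 'X) - L ('X * (1 - 'X)))).
Proof.
set V := (X in Num.sqrt X); pose p := L 'X.
have varE : L (('X - p%:P) ^+ 2) = V.
  by rewrite moment_functional_variance// subrr expr0n/= addr0.
have varE' : L' (('X - p%:P) ^+ 2) = V.
  by rewrite moment_functional_variance// -same_mean -same_q subrr expr0n/= addr0.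
have p01 : 0 <= p <= 1 by exact: moment_functional_mean01.
case: (HL) (HL') => LD LZ _ Lge0 [LD' LZ' _ _].
have V0 : 0 <= V.
  by rewrite -varE; apply: Lge0 => y _; rewrite horner_exp sqr_ge0.
have key e : 0 < e -> `|L (bernstein i j) - L' (bernstein i j)| <=
    2 * ((i + j)%:R * (e + e^-1 * V)).
  move=> e0.
  have LgE : L ((i + j)%:R *: (e%:P + e^-1 *: ('X - p%:P) ^+ 2)) =
      (i + j)%:R * (e + e^-1 * V).
    by rewrite LZ LD LZ moment_functionalC// varE.
  rewrite -LgE; apply: (@moment_functional_compare _ ((bernstein i j).[p])%:P _).
  - by rewrite !moment_functionalC.
  - by rewrite LgE LZ' LD' LZ' moment_functionalC// varE'.
  move=> y y01; rewrite hornerC !bernsteinE !(hornerZ, hornerD, hornerC) horner_exp hornerXsubC.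
  rewrite (le_trans (bernstein_lipschitz i j y01 p01))// ler_wpM2l//.
  rewrite -real_normK ?num_real//; set t := `|y - p|.
  (* [e - t + t^2 / e] is a sum of squares, up to the factor [1 / e]. *)
  rewrite -subr_ge0 (_ : _ - t = e^-1 * ((t - e / 2) ^+ 2 + 3 / 4 * e ^+ 2)).
    by rewrite mulr_ge0 ?invr_ge0 ?(ltW e0)// addr_ge0 ?sqr_ge0// mulr_ge0 ?sqr_ge0.
  by field; exact: lt0r_neq0.
(* For [V = 0] the choice [e = sqrt V] is not available; [e] tends to 0. *)
have [V00|Vp] := eqVneq V 0.
  rewrite V00 sqrtr0 !mulr0.
  apply/ler_addgt0Pr => e e0; rewrite add0r.
  pose N : R := (i + j).+1%:R; have N0 : 0 < N by rewrite ltr0n.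
  have := key (e / (2 * N)); rewrite divr_gt0 ?mulr_gt0// => /(_ isT).
  rewrite V00 mulr0 addr0 => /le_trans; apply.
  have -> : 2 * ((i + j)%:R * (e / (2 * N))) = e * ((i + j)%:R / N).
    by field; rewrite lt0r_neq0.
  by rewrite ger_pMr// ler_pdivrMr// mul1r ler_nat.
have Vgt0 : 0 < V by rewrite lt_def Vp.
have := key (Num.sqrt V); rewrite sqrtr_gt0 => /(_ Vgt0) /le_trans; apply.
rewrite -{3}(sqr_sqrtr V0) expr2 mulKf ?sqrtr_eq0 -?ltNge//.
by rewrite -mulr2n -mulr_natl; lra.
Qed.

End Comparison.

(** * Averages given by a weight, and the fundamental theorem on an open interval *)

Lemma poly_bounded01 (R : realType) (p : {poly R}) :
  exists2 B : R, 0 <= B & forall y, 0 <= y <= 1 -> `|p.[y]| <= B.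
Proof.
exists (\sum_(i < size p) `|p`_i|); first by apply: sumr_ge0.
move=> y /andP[y0 y1]; rewrite horner_coef (le_trans (ler_norm_sum _ _ _))//.
apply: ler_sum => i _; rewrite normrM normrX (ger0_norm y0).
by rewrite ler_piMr// exprn_ile1.
Qed.

Section WeightedMean.
Context d (T : measurableType d) (R : realType).
Variables (mu : {measure set T -> \bar R}) (D : set T) (g w : T -> R).
Hypotheses (mD : measurable D) (mg : measurable_fun D g)
  (g01 : forall x, D x -> 0 <= g x <= 1) (w0 : forall x, D x -> 0 <= w x)
  (iw : mu.-integrable D (EFin \o w)).

Definition weighted_integral (p : {poly R}) : R :=
  \int[mu]_(x in D) (p.[g x] * w x).

Lemma integrable_weighted p : mu.-integrable D (EFin \o (fun x => p.[g x] * w x)).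
Proof.
have [B B0 pB] := poly_bounded01 p.
have mw : measurable_fun D w by apply/measurable_EFinP; exact: (measurable_int mu).
apply: (@le_integrable _ _ _ mu D mD _ (EFin \o (fun x => B * w x))).
- apply/measurable_EFinP; apply: measurable_funM => //.
  by apply: measurableT_comp => //; apply: continuous_measurable_fun; exact: continuous_horner.
- move=> x Dx /=; rewrite lee_fin !normrM ler_wpM2r// (ger0_norm B0).
  by rewrite pB// g01.
- rewrite (_ : _ \o _ = (fun x => B%:E * (EFin \o w) x)%E); last first.
    by apply/funext => x; rewrite /= EFinM.
  exact: integrableZl.
Qed.

Lemma weighted_integralD p q :
  weighted_integral (p + q) = weighted_integral p + weighted_integral q.
Proof.
rewrite /weighted_integral -RintegralD//; try exact: integrable_weighted.
by apply: eq_Rintegral => x _; rewrite hornerD mulrDl.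
Qed.

Lemma weighted_integralZ c p :
  weighted_integral (c *: p) = c * weighted_integral p.
Proof.
rewrite /weighted_integral -RintegralZl//; last exact: integrable_weighted.
by apply: eq_Rintegral => x _; rewrite hornerZ mulrA.
Qed.

Lemma weighted_integral_ge0 p : (forall y, 0 <= y <= 1 -> 0 <= p.[y]) ->
  0 <= weighted_integral p.
Proof.
by move=> p0; apply: Rintegral_ge0 => x Dx; rewrite mulr_ge0 ?p0 ?g01 ?w0.
Qed.

Lemma weighted_integral_functional : 0 < weighted_integral 1 ->
  moment_functional (fun p => weighted_integral p / weighted_integral 1).
Proof.
move=> c0; split.
- by move=> p q; rewrite weighted_integralD mulrDl.
- by move=> c p; rewrite weighted_integralZ mulrA.
- by rewrite divff// gt_eqF.
- by move=> p p0; rewrite divr_ge0 ?(ltW c0)// weighted_integral_ge0.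
Qed.

End WeightedMean.

Section FTC_open.
Variable R : realType.
Notation mu := (@lebesgue_measure R).

(** The integrand may blow up at both ends, as the beta density does when its
    parameters are below 1; the integral is the limit of those over
    [[1/(m+3), 1 - 1/(m+3)]]. *)
Lemma ge0_FTC_itvoo (f F : R -> R) :
  (forall x, 0 < x < 1 -> 0 <= f x) ->
  {in `]0, 1[, continuous f} ->
  {in `]0, 1[, forall x : R, is_derive x 1 F (f x)} ->
  F x @[x --> 0^'+] --> F 0 -> F x @[x --> 1^'-] --> F 1 ->
  (\int[mu]_(x in `]0%R, 1%R[) (f x)%:E = (F 1 - F 0)%:E)%E.
Proof.
move=> f0 cf dF F0 F1.
(* The shift by 3 makes [a n < 1 - a n] for every [n]. *)
pose a n : R := n.+3%:R^-1.
have a0 n : 0 < a n by rewrite invr_gt0.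
have a12 n : a n < 1 - a n.
  rewrite ltrBrDr -mulr2n -mulr_natr ltr_pdivrMl ?ltr0n// mulr1.
  by rewrite ltr_nat.
have am m n : (m <= n)%N -> a n <= a m.
  by move=> mn; rewrite lef_pV2 ?posrE// ler_nat !ltnS.
have acvg : a n @[n --> \oo] --> 0.
  have := @cvg_harmonic R; rewrite -(cvg_shiftn 2); apply: cvg_trans.
  by apply: near_eq_cvg; near=> n; rewrite /= /harmonic /a addn2.
pose S n := [set` `[a n, 1 - a n]] : set R.
have SE : `]0, 1[%classic = \bigcup_n S n.
  apply/seteqP; split => x /=; last first.
    move=> [n _]; rewrite /S /= !in_itv/= => /andP[h1 h2].
    by rewrite (lt_le_trans (a0 n) h1)/= (le_lt_trans h2)// gtrBl.
  rewrite in_itv/= => /andP[x0 x1].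
  have : \forall n \near \oo, a n < Num.min x (1 - x).
    have : 0 < Num.min x (1 - x) by rewrite lt_min x0 subr_gt0.
    by move=> m0; move/cvgrPdist_lt : acvg => /(_ _ m0); apply: filterS => n;
      rewrite sub0r normrN gtr0_norm.
  move=> [N _ /(_ N (leqnn N))]; rewrite lt_min => /andP[h1 h2].
  exists N => //; rewrite /S /= in_itv/= (ltW h1)/=; lra.
have Soo n x : S n x -> x \in `]0, 1[%R.
  by move=> Sx; have : (\bigcup_n S n) x by [exists n]; rewrite -SE.
have mf n : measurable_fun (S n) f.
  apply: subspace_continuous_measurable_fun; first exact: measurable_itv.
  by apply: continuous_in_subspaceT => x; rewrite inE => /Soo; exact: cf.
have intS n : (\int[mu]_(x in S n) (f x)%:E = (F (1 - a n) - F (a n))%:E)%E.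
  have sub x : x \in `]a n, 1 - a n[ -> x \in `]0, 1[.
    by move=> h; apply: (Soo n); rewrite /S/=; exact: subset_itv_oo_cc h.
  rewrite (@continuous_FTC2 _ f F)//.
  - by apply: continuous_in_subspaceT => x; rewrite inE => /Soo; exact: cf.
  - have cF x : x \in `]0, 1[ -> {for x, continuous F}.
      move=> /dF h; apply: differentiable_continuous.
      by apply/derivable1_diffP; exact: ex_derive.
    split.
    + by move=> x /sub /dF h; exact: ex_derive.
    + apply/cvg_at_right_filter/cF; apply: (Soo n).
      by rewrite /S /= in_itv/= lexx (ltW (a12 n)).
    + apply/cvg_at_left_filter/cF; apply: (Soo n).
      by rewrite /S /= in_itv/= lexx (ltW (a12 n)).
  - by move=> x /sub /dF h; rewrite derive1E; exact: derive_val.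
have lim1 : (\int[mu]_(x in S n) (f x)%:E @[n --> \oo] -->
    \int[mu]_(x in `]0%R, 1%R[) (f x)%:E)%E.
  rewrite SE; apply: ge0_nondecreasing_set_cvg_integral.
  - move=> m n mn; apply/subsetPset => x; rewrite /S/= !in_itv/= => /andP[h1 h2].
    by have := am _ _ mn; lra.
  - by move=> n; exact: measurable_itv.
  - by move=> n; apply/measurable_EFinP; exact: mf.
  - move=> n x Sx; have := Soo n x Sx; rewrite in_itv/= lee_fin; exact: f0.
have lim2 : (\int[mu]_(x in S n) (f x)%:E @[n --> \oo] --> (F 1 - F 0)%:E)%E.
  under eq_fun do rewrite intS.
  apply: cvg_EFin; first by near=> n.
  apply: cvgB.
    apply: ((cvg_at_leftP F 1 _).1 F1); split=> [n|]; first by rewrite gtrBl.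
    by rewrite -[X in _ --> X]subr0; apply: cvgB acvg; exact: cvg_cst.
  by apply: ((cvg_at_rightP F 0 _).1 F0); split.
exact: (cvg_unique _ lim1 lim2).
Unshelve. all: by end_near. Qed.
End FTC_open.

(** * The beta integral with real parameters *)

Lemma Rintegral_gt0 d (T : measurableType d) (R : realType)
    (mu : {measure set T -> \bar R}) (D E : set T) (f : T -> R) :
  measurable D -> mu.-integrable D (EFin \o f) ->
  (forall x, D x -> 0 <= f x) ->
  measurable E -> E `<=` D -> (forall x, E x -> 0 < f x) -> mu E != 0%E ->
  0 < \int[mu]_(x in D) f x.
Proof.
move=> mD intf f0 mE ED fE muE; rewrite lt_def Rintegral_ge0// andbT.
apply/eqP => I0; move/eqP: muE; apply; apply/negligibleP => //.
have mf := measurable_int mu intf.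
have [+ _] := ae_eq_integral_abs mu mD mf.
have -> : (\int[mu]_(x in D) `|(EFin \o f) x| = 0)%E.
  transitivity (\int[mu]_(x in D) (f x)%:E)%E.
    by apply: eq_integral => x; rewrite inE => /f0 fx /=; rewrite ger0_norm.
  by rewrite -[LHS]fineK ?integrable_fin_num// -[X in X%:E]/(\int[mu]_(x in D) f x) I0.
move=> /(_ erefl); apply: negligibleS => x Ex /= /(_ (ED _ Ex))[] fx0.
by have := fE _ Ex; rewrite fx0 ltxx.
Qed.

Section BetaIntegral.
Variable R : realType.
Notation mu := (@lebesgue_measure R).
Implicit Types a b y : R.

Definition beta_weight a b y := y `^ (a - 1) * (1 - y) `^ (b - 1).

Lemma is_derive_powR1B b y : y < 1 ->
  is_derive y 1 (fun z : R => (1 - z) `^ b) (- (b * (1 - y) `^ (b - 1))).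
Proof.
move=> y1; have y1' : 0 < 1 - y by rewrite subr_gt0.
have h1 := is_derive1_powR b y1'.
have h2 : is_derive y (1:R) (fun z : R => 1 - z) (-1).
  have -> : (fun z : R => 1 - z) = (cst 1 - id) by [].
  by have := is_deriveB (is_derive_cst (1:R) y 1) (is_derive_id y (1:R)); rewrite sub0r.
have := @is_derive1_comp _ (fun z => z `^ b) (fun z => 1 - z) y _ _ h1 h2.
by rewrite mulrN1.
Qed.

Lemma continuous_derive1 (f : R -> R) (df y : R) :
  is_derive y 1 f df -> {for y, continuous f}.
Proof.
move=> h; apply: differentiable_continuous.
by apply/derivable1_diffP; exact: ex_derive.
Qed.

Lemma continuous_powR b y : 0 < y -> {for y, continuous (fun z : R => z `^ b)}.
Proof. by move=> y0; apply: continuous_derive1; exact: is_derive1_powR. Qed.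

Lemma continuous_powR1B b y : y < 1 -> {for y, continuous (fun z : R => (1 - z) `^ b)}.
Proof. by move=> y1; apply: continuous_derive1; exact: is_derive_powR1B. Qed.

Lemma powR1B_cvg0 b : 0 < b -> (1 - y) `^ b @[y --> (1:R)^'-] --> (0:R).
Proof.
move=> b0; apply/cvg_at_leftP => u [u1 cu].
apply: ((cvg_at_rightP (fun z => z `^ b) 0 0).1 (powR_cvg0 b0)); split.
  by move=> n; rewrite subr_gt0.
by rewrite -(subrr 1); apply: cvgB cu; exact: cvg_cst.
Qed.

Lemma itvoo01P y : reflect (0 < y /\ y < 1) (y \in `]0, 1[%R).
Proof. by rewrite in_itv/=; exact: andP. Qed.

Lemma integral_powR a : 0 < a ->
  (\int[mu]_(y in `]0%R, 1%R[) (a * y `^ (a - 1))%:E = 1)%E.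
Proof.
move=> a0; rewrite (@ge0_FTC_itvoo _ _ (fun y => y `^ a)).
- by rewrite powR1 powR0 ?gt_eqF// subr0.
- by move=> y /andP[y0 _]; rewrite mulr_ge0 ?(ltW a0)// powR_ge0.
- move=> y /itvoo01P[y0 y1]; apply: cvgM; first exact: cvg_cst.
  exact: continuous_powR.
- by move=> y /itvoo01P[y0 y1]; exact: is_derive1_powR.
- by rewrite powR0 ?gt_eqF//; exact: powR_cvg0.
- by apply/cvg_at_left_filter; exact: continuous_powR.
Qed.

Lemma integral_powR1B b : 0 < b ->
  (\int[mu]_(y in `]0%R, 1%R[) (b * (1 - y) `^ (b - 1))%:E = 1)%E.
Proof.
move=> b0; rewrite (@ge0_FTC_itvoo _ _ (fun y => - (1 - y) `^ b)).
- by rewrite subrr subr0 powR1 powR0 ?gt_eqF// oppr0 sub0r opprK.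
- by move=> y /andP[_ y1]; rewrite mulr_ge0 ?(ltW b0)// powR_ge0.
- move=> y /itvoo01P[y0 y1]; apply: cvgM; first exact: cvg_cst.
  exact: continuous_powR1B.
- move=> y /itvoo01P[y0 y1]; rewrite -[X in is_derive _ _ _ X]opprK.
  by apply: is_deriveN; exact: is_derive_powR1B.
- by apply/cvg_at_right_filter; apply: cvgN; exact: continuous_powR1B.
- rewrite subrr powR0 ?gt_eqF//; apply: cvgN; exact: powR1B_cvg0.
Qed.

Lemma ge0_integrable_of_fin (f : R -> R) :
  measurable_fun (`]0, 1[ : set R) f -> (forall y, 0 < y < 1 -> 0 <= f y) ->
  (\int[mu]_(y in `]0%R, 1%R[) (f y)%:E < +oo)%E ->
  mu.-integrable `]0%R, 1%R[ (EFin \o f).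
Proof.
move=> mf f0 foo; apply/integrableP; split; first exact/measurable_EFinP.
rewrite (_ : integral _ _ _ = \int[mu]_(y in `]0%R, 1%R[) (f y)%:E)%E//.
apply: eq_integral => y; rewrite inE/= in_itv/= => y01.
by rewrite ger0_norm// f0.
Qed.

Lemma measurable_itvoo01 (f : R -> R) : {in `]0, 1[, continuous f} ->
  measurable_fun (`]0, 1[ : set R) f.
Proof.
move=> cf; apply: subspace_continuous_measurable_fun; first exact: measurable_itv.
by apply: continuous_in_subspaceT => x; rewrite inE; exact: cf.
Qed.

Lemma continuous_beta_weight a b : {in `]0, 1[, continuous (beta_weight a b)}.
Proof.
move=> y /itvoo01P[y0 y1]; apply: cvgM; first exact: continuous_powR.
exact: continuous_powR1B.
Qed.

Lemma beta_weight_ge0 a b y : 0 <= beta_weight a b y.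
Proof. by rewrite mulr_ge0// powR_ge0. Qed.

Lemma powR_le1 a y : 0 <= a -> 0 <= y <= 1 -> y `^ a <= 1.
Proof.
move=> a0 /andP[y0 y1]; have <- : (1 : R) `^ a = 1 by rewrite powR1.
by apply: ge0_ler_powR; rewrite ?nnegrE.
Qed.

Section Positive.
Variables (a b : R).
Hypotheses (a0 : 0 < a) (b0 : 0 < b).

Lemma integrable_powR1B :
  mu.-integrable `]0%R, 1%R[ (EFin \o (fun y => b * (1 - y) `^ (b - 1))).
Proof.
apply: ge0_integrable_of_fin.
- apply: measurable_itvoo01 => y /itvoo01P[y0 y1].
  by apply: cvgM; [exact: cvg_cst|exact: continuous_powR1B].
- by move=> y /andP[_ y1]; rewrite mulr_ge0 ?(ltW b0)// powR_ge0.
- by rewrite integral_powR1B// ltry.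
Qed.

Lemma integrable_powR :
  mu.-integrable `]0%R, 1%R[ (EFin \o (fun y => a * y `^ (a - 1))).
Proof.
apply: ge0_integrable_of_fin.
- apply: measurable_itvoo01 => y /itvoo01P[y0 y1].
  by apply: cvgM; [exact: cvg_cst|exact: continuous_powR].
- by move=> y /andP[_ y1]; rewrite mulr_ge0 ?(ltW a0)// powR_ge0.
- by rewrite integral_powR// ltry.
Qed.

Lemma beta_weightS1 y : 0 < y < 1 ->
  y * beta_weight a b y = y `^ a * (1 - y) `^ (b - 1).
Proof. by move=> /andP[y0 y1]; rewrite mulrA mulr_powRB1// ltW. Qed.

Lemma beta_weight1S y : 0 < y < 1 ->
  (1 - y) * beta_weight a b y = y `^ (a - 1) * (1 - y) `^ b.
Proof.
by move=> /andP[y0 y1]; rewrite mulrCA mulr_powRB1// subr_ge0 ltW.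
Qed.

(** Splitting [1 = y + (1 - y)] bounds the weight by [y^(a-1) + (1-y)^(b-1)]:
    each of the two singularities is then integrable on its own. *)
Lemma integrable_beta_weight :
  mu.-integrable `]0%R, 1%R[ (EFin \o beta_weight a b).
Proof.
apply: (@le_integrable _ _ _ mu _ (measurable_itv _) _
  (EFin \o (fun y => a^-1 * (a * y `^ (a - 1)) + b^-1 * (b * (1 - y) `^ (b - 1))))).
- apply/measurable_EFinP; apply: measurable_itvoo01.
  exact: continuous_beta_weight.
- move=> y; rewrite /= in_itv/= => y01; rewrite lee_fin ger0_norm ?beta_weight_ge0//.
  rewrite !mulKf ?gt_eqF// ger0_norm ?addr_ge0 ?powR_ge0//.
  have -> : beta_weight a b y = y * beta_weight a b y + (1 - y) * beta_weight a b y.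
    by ring.
  rewrite beta_weightS1// beta_weight1S// addrC; case/andP: y01 => y0 y1.
  rewrite lerD//.
    by rewrite ler_piMr ?powR_ge0// powR_le1 ?(ltW b0)//; lra.
  by rewrite ler_piMl ?powR_ge0// powR_le1 ?(ltW a0)//; lra.
- rewrite (_ : _ \o _ = (fun y => a^-1%:E * (a * y `^ (a - 1))%:E
     + b^-1%:E * (b * (1 - y) `^ (b - 1))%:E)%E); last first.
    by apply/funext => y /=; rewrite -!EFinM -EFinD.
  by apply: integrableD => //; apply: integrableZl => //;
    [exact: integrable_powR|exact: integrable_powR1B].
Qed.

(** The integrand is the derivative of [y^a (1 - y)^b], whose boundary values
    vanish.  It changes sign, so the fundamental theorem is applied after adding
    [b (1 - y)^(b - 1)], which makes it nonnegative and has integral 1. *)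
Lemma integral_beta_by_parts :
  \int[mu]_(y in `]0%R, 1%R[) ((a - (a + b) * y) * beta_weight a b y) = 0.
Proof.
pose f y := (a - (a + b) * y) * beta_weight a b y + b * (1 - y) `^ (b - 1).
have fE : (\int[mu]_(y in `]0%R, 1%R[) (f y)%:E = 1)%E.
  rewrite (@ge0_FTC_itvoo _ _ (fun y => y `^ a * (1 - y) `^ b - (1 - y) `^ b)).
  - rewrite !subrr !subr0 !powR1 !powR0 ?gt_eqF//.
    by rewrite mulr0 mul0r subr0 !sub0r opprK.
  - move=> y y01; rewrite /f.
    have -> : (a - (a + b) * y) * beta_weight a b y =
       a * ((1 - y) * beta_weight a b y) - b * (y * beta_weight a b y) by ring.
    rewrite beta_weightS1// -addrA addr_ge0//.
      rewrite mulr_ge0 ?(ltW a0)// mulr_ge0 ?beta_weight_ge0//; lra.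
    rewrite [leRHS]addrC subr_ge0 ler_wpM2l ?(ltW b0)//.
    by rewrite ler_piMl ?powR_ge0// powR_le1 ?(ltW a0)//; lra.
  - move=> y y01; have /itvoo01P[y0 y1] := y01; apply: cvgD; apply: cvgM.
    + apply: cvgB; first exact: cvg_cst.
      by apply: cvgM; [exact: cvg_cst|exact: cvg_id].
    + exact: continuous_beta_weight.
    + exact: cvg_cst.
    + exact: continuous_powR1B.
  - move=> y; rewrite in_itv/= => y01; have /andP[y0 y1] := y01.
    have h1 := is_derive1_powR a y0; have h2 := is_derive_powR1B b y1.
    have h := is_deriveB (is_deriveM h1 h2) h2.
    rewrite (_ : f y = y `^ a *: - (b * (1 - y) `^ (b - 1)) +
       (1 - y) `^ b *: (a * y `^ (a - 1)) - - (b * (1 - y) `^ (b - 1)))//.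
    rewrite /f /GRing.scale/=.
    have -> : (a - (a + b) * y) * beta_weight a b y =
       a * ((1 - y) * beta_weight a b y) - b * (y * beta_weight a b y) by ring.
    by rewrite beta_weightS1// beta_weight1S//; ring.
  - rewrite powR0 ?gt_eqF// mul0r; apply: cvgB.
      rewrite -[X in _ --> X](mul0r ((1 - 0) `^ b)); apply: cvgM; first exact: powR_cvg0.
      by apply/cvg_at_right_filter; exact: continuous_powR1B.
    by apply/cvg_at_right_filter; exact: continuous_powR1B.
  - rewrite subrr powR0 ?gt_eqF//; apply: cvgB; last exact: powR1B_cvg0.
    apply: cvgM; last exact: powR1B_cvg0.
    by apply/cvg_at_left_filter; exact: continuous_powR.
have If : mu.-integrable `]0%R, 1%R[ (EFin \o (fun y => (a - (a + b) * y) * beta_weight a b y)).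
  have := @integrable_weighted _ _ _ mu `]0%R, 1%R[ id (beta_weight a b)
    (measurable_itv _) (@measurable_id _ _ _) _ integrable_beta_weight (a%:P - (a + b)%:P * 'X).
  rewrite (_ : (fun x => _) = (fun y => (a - (a + b) * y) * beta_weight a b y)).
    by apply; move=> x /=; rewrite in_itv/= => /andP[/ltW -> /ltW ->].
  by apply/funext => y; rewrite !hornerE.
have : \int[mu]_(y in `]0%R, 1%R[) f y = 1 by rewrite /Rintegral fE.
rewrite /f RintegralD//; last exact: integrable_powR1B.
rewrite [X in _ + X](_ : _ = 1); last by rewrite /Rintegral integral_powR1B.
by move=> /(congr1 (fun x => x - 1)); rewrite addrK subrr.
Qed.

End Positive.
End BetaIntegral.

Section BetaFunctional.
Variable R : realType.
Notation mu := (@lebesgue_measure R).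

Definition beta_integral (a b : R) : {poly R} -> R :=
  weighted_integral mu `]0%R, 1%R[ id (beta_weight a b).

Lemma itvoo01_sub01 (x : R) : x \in `]0, 1[%R -> 0 <= x <= 1.
Proof. by rewrite in_itv/= => /andP[/ltW -> /ltW ->]. Qed.

Lemma beta_weight_shift (a b : R) i j (y : R) : 0 < y < 1 ->
  beta_weight (a + i%:R) (b + j%:R) y = (bernstein i j).[y] * beta_weight a b y.
Proof.
have shift c k z : 0 < z -> z `^ (c + k%:R - 1) = z ^+ k * z `^ (c - 1) :> R.
  move=> z0; rewrite (_ : c + k%:R - 1 = k%:R + (c - 1)); last by ring.
  by rewrite powRD ?powR_mulrn ?(ltW z0)// (gt_eqF z0) implybT.
move=> /andP[y0 y1]; rewrite bernsteinE /beta_weight !shift// ?subr_gt0//.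
by ring.
Qed.

Section Positive.
Variables (a b : R).
Hypotheses (a0 : 0 < a) (b0 : 0 < b).

Let I (p : {poly R}) :
  mu.-integrable `]0%R, 1%R[ (EFin \o (fun y => p.[id y] * beta_weight a b y)).
Proof.
apply: integrable_weighted => //; first exact: itvoo01_sub01.
exact: integrable_beta_weight.
Qed.

Lemma BetaE i j : Beta (a + i%:R) (b + j%:R) = beta_integral a b (bernstein i j).
Proof.
have ai : 0 < a + i%:R by rewrite ltr_wpDr.
have bj : 0 < b + j%:R by rewrite ltr_wpDr.
have h := integrable_beta_weight ai bj.
have mw : measurable_fun (`]0, 1[ : set R) (beta_weight (a + i%:R) (b + j%:R)).
  by apply: measurable_itvoo01; exact: continuous_beta_weight.
transitivity (\int[mu]_(y in `]0%R, 1%R[) beta_weight (a + i%:R) (b + j%:R) y).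
  congr fine; rewrite -integral_itv_bndo_bndc; last first.
    by apply/emeasurable_fun_itv_obnd_cbndP/measurable_EFinP.
  by rewrite -integral_itv_obnd_cbnd//; exact/measurable_EFinP.
apply: eq_Rintegral => y; rewrite inE/= in_itv/= => y01.
by rewrite beta_weight_shift.
Qed.

Lemma beta_integralB p q :
  beta_integral a b (p - q) = beta_integral a b p - beta_integral a b q.
Proof.
rewrite /beta_integral /weighted_integral -RintegralB//; try exact: I.
by apply: eq_Rintegral => y _; rewrite hornerD hornerN mulrBl.
Qed.

Lemma beta_integralZ c p : beta_integral a b (c *: p) = c * beta_integral a b p.
Proof.
rewrite /beta_integral /weighted_integral -RintegralZl//; try exact: I.
by apply: eq_Rintegral => y _; rewrite hornerZ; ring.
Qed.

Lemma beta_integral_gt0 : 0 < beta_integral a b 1.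
Proof.
rewrite /beta_integral /weighted_integral.
apply: (@Rintegral_gt0 _ _ R mu _ (`]0%R, 1%R[%classic : set R)).
- exact: measurable_itv.
- exact: I.
- by move=> x _; rewrite hornerC mul1r beta_weight_ge0.
- exact: measurable_itv.
- by [].
- move=> x; rewrite /= in_itv/= => /andP[x0 x1].
  by rewrite hornerC mul1r mulr_gt0// powR_gt0// subr_gt0.
- have := lebesgue_measure_itv (`]0, 1[ : interval R).
  by rewrite /= lte_fin ltr01 oppr0 adde0 => ->; rewrite oner_neq0.
Qed.

Lemma beta_integral_functional :
  moment_functional (fun p => beta_integral a b p / beta_integral a b 1).
Proof.
apply: weighted_integral_functional => //.
- exact: itvoo01_sub01.
- by move=> x _; exact: beta_weight_ge0.
- exact: integrable_beta_weight.
- exact: beta_integral_gt0.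
Qed.

Lemma beta_integralX :
  beta_integral a b 'X = a / (a + b) * beta_integral a b 1.
Proof.
have := integral_beta_by_parts a0 b0.
have -> : \int[mu]_(y in `]0%R, 1%R[) ((a - (a + b) * y) * beta_weight a b y) =
    beta_integral a b (a *: 1 - (a + b) *: 'X).
  by apply: eq_Rintegral => y _; rewrite !hornerE.
rewrite beta_integralB !beta_integralZ.
move=> /eqP; rewrite subr_eq0 => /eqP h.
have ab : a + b != 0 by rewrite gt_eqF ?addr_gt0.
by apply: (mulfI ab); rewrite -h; field.
Qed.

End Positive.

(** Raising [a] by 1 multiplies the weight by [y]; this is how the second moment
    reduces to the first. *)
Lemma beta_integral_XS (a b : R) (p : {poly R}) : 0 < a -> 0 < b ->
  beta_integral (a + 1) b p = beta_integral a b ('X * p).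
Proof.
move=> a0 b0; apply: eq_Rintegral => y; rewrite inE/= in_itv/= => y01.
have := @beta_weight_shift a b 1 0 y y01; rewrite addr0 => ->.
by rewrite bernsteinE hornerM hornerX expr1 expr0 mulr1; ring.
Qed.

Lemma beta_integralX1X (a b : R) : 0 < a -> 0 < b ->
  beta_integral a b ('X * (1 - 'X)) =
  a * b / ((a + b) * (a + b + 1)) * beta_integral a b 1.
Proof.
move=> a0 b0; have a1 : 0 < a + 1 by rewrite addr_gt0.
rewrite mulrBr mulr1 beta_integralB// -beta_integral_XS//.
rewrite [beta_integral (a + 1) _ _]beta_integralX// beta_integral_XS// mulr1.
rewrite beta_integralX//.
have ab : a + b != 0 by rewrite gt_eqF ?addr_gt0.
have ab1 : a + b + 1 != 0 by rewrite gt_eqF ?addr_gt0.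
have ab1' : a + 1 + b != 0 by rewrite addrAC.
by field; rewrite ab1 ab.
Qed.
End BetaFunctional.

(** * The normal law and its distribution function *)

Section NormalLaw.
Variable R : realType.
Notation mu := (@lebesgue_measure R).
Implicit Types m s x y z : R.

Lemma normal_pdf_affine m s z : 0 < s ->
  normal_pdf m s (m + s * z) * s = normal_pdf 0 1 z.
Proof.
move=> s0; rewrite !normal_pdfE ?gt_eqF// /normal_peak /normal_fun.
have -> : - (m + s * z - m) ^+ 2 / (s ^+ 2 *+ 2) = - (z - 0) ^+ 2 / (1 ^+ 2 *+ 2).
  by rewrite subr0 expr1n -mulr_natr; field; rewrite gt_eqF.
rewrite -mulrnAr sqrtrM ?sqr_ge0// sqrtr_sqr gtr0_norm// expr1n mul1r.
by rewrite invfM; set e := expR _; set c := (Num.sqrt _)^-1; field; rewrite gt_eqF.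
Qed.

Lemma normal_prob_affine m s x : 0 < s ->
  normal_prob m s `]-oo, (m + s * x)] = normal_prob 0 1 `]-oo, x].
Proof.
move=> s0; pose F z := m + s * z.
have dF z : is_derive z 1 F s.
  rewrite /F.
  have h : is_derive z (1 : R) (cst m + s \*: id) (0 + s *: 1).
    by apply: is_deriveD.
  by move: h; rewrite add0r /GRing.scale/= mulr1.
have F'E : derive1 F = cst s.
  by apply/funext => z; rewrite derive1E; exact: derive_val.
have cF z : {for z, continuous F} by exact: continuous_derive1 (dF z).
rewrite /normal_prob -[m + s * x]/(F x).
rewrite (@increasing_ge0_integration_by_substitutionNy _ F).
- by apply: eq_integral => z _; rewrite F'E /= -(normal_pdf_affine m z s0).
- by move=> y z _ _ yz; rewrite /F ltrD2l ltr_pM2l.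
- by move=> z _; rewrite F'E; exact: cvg_cst.
- by rewrite F'E; exact: is_cvg_cst.
- by rewrite F'E; exact: cvg_cst.
- by split; [move=> z _; exact: ex_derive|apply/cvg_at_left_filter; exact: cF].
- apply/cvgrNyPle => A; have := nbhs_ninfty_le (num_real (s^-1 * (A - m))).
  by apply: filterS => z; rewrite ler_pdivlMl// lerBrDl.
- by apply: continuous_subspaceT; apply: continuous_normal_pdf; rewrite gt_eqF.
- by move=> z _; exact: normal_pdf_ge0.
Qed.

End NormalLaw.

Section PhiFacts.
Variable R : realType.
Notation mu := (@lebesgue_measure R).
Implicit Types m s x y z : R.

Lemma PhiE x : normal_prob 0 1 `]-oo, x] = (Phi x)%:E.
Proof. by rewrite /Phi fineK// fin_num_measure. Qed.

Lemma normal_prob_Ny m s x : 0 < s ->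
  normal_prob m s `]-oo, x] = (Phi ((x - m) / s))%:E.
Proof.
move=> s0; rewrite -PhiE -(normal_prob_affine m _ s0).
by have -> : m + s * ((x - m) / s) = x by field; rewrite gt_eqF.
Qed.

Lemma Phi_itv x y : x <= y -> normal_prob 0 1 `]x, y] = (Phi y - Phi x)%:E.
Proof.
move=> xy; have -> : `]x, y]%classic = `]-oo, y] `\` `]-oo, x].
  apply/seteqP; split => z /=; rewrite !in_itv/=.
    by move=> /andP[xz ->]; split => //; apply/negP; rewrite -ltNge.
  by move=> [-> /negP]; rewrite -ltNge => ->.
rewrite measureD//=; last by rewrite -ge0_fin_numE// fin_num_measure.
rewrite (_ : `]-oo, y] `&` `]-oo, x] = `]-oo, x]%classic).
  by rewrite EFinB -!PhiE.
by apply/setIidPr => z /=; rewrite !in_itv/= => /le_trans; apply.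
Qed.

Lemma Phi_lipschitz x y : `|Phi y - Phi x| <= normal_peak 1 * `|y - x|.
Proof.
wlog xy : x y / x <= y.
  move=> H; have [/H//|/ltW/H] := leP x y.
  by rewrite distrC (distrC x).
rewrite ger0_norm ?[`|y - x|]ger0_norm ?subr_ge0//; last first.
  by rewrite -subr_ge0 -lee_fin -Phi_itv.
rewrite -lee_fin -Phi_itv// /normal_prob.
apply: (@le_trans _ _ (\int[mu]_(z in `]x, y]) (normal_peak 1 : R)%:E)%E).
  apply: ge0_le_integral => //.
  - by move=> z _; rewrite lee_fin normal_pdf_ge0.
  - by apply/measurable_EFinP; apply: measurable_funTS; exact: measurable_normal_pdf.
  - by move=> z _; rewrite lee_fin normal_pdf_ub ?oner_eq0.
rewrite integral_cst//= lebesgue_measure_itv/= lte_fin.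
case: ltP => [_|yx]; first by rewrite -EFinD -EFinM.
by rewrite mule0 lee_fin mulr_ge0 ?normal_peak_ge0// subr_ge0.
Qed.

Lemma Phi_lt x y : x < y -> Phi x < Phi y.
Proof.
move=> xy; rewrite -subr_gt0 -lte_fin -Phi_itv ?ltW// /normal_prob.
(* A lower bound of the density on [x, y], as [z^2 <= x^2 + y^2] there. *)
pose c : R := normal_peak 1 * expR (- (x ^+ 2 + y ^+ 2) / 2).
have c0 : 0 < c by rewrite mulr_gt0 ?expR_gt0// normal_peak_gt0 ?oner_eq0.
apply: (@lt_le_trans _ _ (\int[mu]_(z in `]x, y]) c%:E)%E).
  rewrite integral_cst//= lebesgue_measure_itv/= lte_fin xy -EFinD -EFinM lte_fin.
  by rewrite mulr_gt0// subr_gt0.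
apply: ge0_le_integral => //.
- by move=> z _; rewrite lee_fin ltW.
- by apply/measurable_EFinP; apply: measurable_funTS; exact: measurable_normal_pdf.
- move=> z /=; rewrite in_itv/= => /andP[xz zy].
  rewrite lee_fin normal_pdfE ?oner_eq0// ler_wpM2l ?normal_peak_ge0//.
  rewrite ler_expR subr0 expr1n ler_pM2r// lerN2.
  by have [z0|z0] := leP 0 z; nra.
Qed.

Lemma Phi_le : {homo (@Phi R) : x y / x <= y}.
Proof. by move=> x y; rewrite le_eqVlt => /predU1P[->//|/Phi_lt/ltW]. Qed.

Lemma measurable_Phi : measurable_fun setT (@Phi R).
Proof. by apply: nondecreasing_measurable => // x y; exact: Phi_le. Qed.

Lemma Phi_opp x : Phi (- x) = 1 - Phi x.
Proof.
apply: EFin_inj; rewrite -PhiE /normal_prob.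
rewrite ge0_integration_by_substitutionNy; last 2 first.
- by apply: continuous_subspaceT; apply: continuous_normal_pdf; rewrite oner_eq0.
- by move=> z _; exact: normal_pdf_ge0.
under eq_integral => z _.
  rewrite (_ : _ z = normal_pdf 0 1 z); last first.
    by rewrite /= !normal_pdfE ?oner_eq0// /normal_fun !subr0 sqrrN.
  over.
rewrite -[LHS]/(normal_prob 0 1 `[x, +oo[).
have -> : `[x, +oo[%classic = ~` `]-oo, x[ by rewrite setCitvl.
rewrite probability_setC// EFinB -PhiE; congr (_ - _)%E.
by rewrite /normal_prob -integral_itv_bndo_bndc//;
  apply/measurable_EFinP; apply: measurable_funTS; exact: measurable_normal_pdf.
Qed.

Lemma Phi_gt0 x : 0 < Phi x.
Proof.
apply: (@le_lt_trans _ _ (Phi (x - 1))); last by rewrite Phi_lt// gtrBl.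
by rewrite fine_ge0.
Qed.

Lemma Phi_lt1 x : Phi x < 1.
Proof. by have := Phi_gt0 (- x); rewrite Phi_opp subr_gt0. Qed.

Lemma Phi_cvgNy : Phi x @[x --> -oo] --> (0 : R).
Proof.
pose idR (x : measurableTypeR R) : R := x.
have mid : measurable_fun setT idR by exact: measurable_id.
pose P : probability (measurableTypeR R) R := normal_prob 0 1.
pose X : {RV P >-> R} := mfun_Sub (mem_set mid).
have /fine_cvg := cvg_cdfNy0 X; apply: cvg_trans.
by apply: near_eq_cvg; near=> x.
Unshelve. all: by end_near. Qed.

End PhiFacts.

Section NormalTransfer.
Variable R : realType.
Notation mu := (@lebesgue_measure R).
Implicit Types m s x y z : R.

Lemma normal_prob_Nyo m s x :
  normal_prob m s `]-oo, x[ = normal_prob m s `]-oo, x].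
Proof.
by rewrite /normal_prob integral_itv_bndo_bndc//;
  apply/measurable_EFinP; apply: measurable_funTS; exact: measurable_normal_pdf.
Qed.

Definition affine m s (z : measurableTypeR R) : measurableTypeR R := m + s * z.

Lemma measurable_affine m s : measurable_fun setT (affine m s).
Proof.
apply: (@measurable_funD _ _ R setT (cst m) (fun z => s * z)) => //.
exact: measurable_funM.
Qed.

(** The half-lines form a generating pi-system, so
    [normal_prob_Ny] determines the law. *)
Lemma normal_prob_pushforward m s (A : set (measurableTypeR R)) : 0 < s -> measurable A ->
  normal_prob m s A = pushforward (normal_prob 0 1) (affine m s) A.
Proof.
move=> s0 mA; pose F := affine m s.
have mF : measurable_fun setT F by exact: measurable_affine.
pose nu : {measure set (measurableTypeR R) -> \bar R} :=
  pushforward (normal_prob 0 1) F.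
refine (@measure_unique _ R (measurableTypeR R) (@RGenInftyO.G R) (fun n => `]-oo, n%:R[%classic)
  _ _ _ _ (normal_prob m s) (nu mF) _ _ A mA) => //.
- exact: RGenInftyO.measurableE.
- move=> _ _ [x ->] [y ->]; exists (Num.min x y).
  by apply/seteqP; split => z /=; rewrite !in_itv/= lt_min => /andP.
- by move=> n; exists n%:R.
- apply/seteqP; split => // z _.
  exists (Num.trunc `|z|).+1 => //=; rewrite in_itv/=.
  by rewrite (le_lt_trans (ler_norm _))// truncnS_gt.
- move=> _ [x ->]; rewrite -[LHS]/(normal_prob m s `]-oo, x[).
  rewrite -[RHS]/(normal_prob 0 1 (F @^-1` `]-oo, x[)).
  rewrite normal_prob_Nyo normal_prob_Ny// -PhiE -normal_prob_Nyo.
  congr (normal_prob _ _ _); apply/seteqP; split => z /=; rewrite !in_itv/= /F /affine.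
    by rewrite ltr_pdivlMr// mulrC ltrBrDl.
  by rewrite ltr_pdivlMr// mulrC ltrBrDl.
- by move=> n; rewrite -ge0_fin_numE// fin_num_measure.
Qed.

Lemma ge0_integral_normal_affine m s (f : R -> \bar R) : 0 < s ->
  measurable_fun setT f -> (forall x, 0%E <= f x)%E ->
  (\int[normal_prob m s]_x f x = \int[normal_prob 0 1]_z f (affine m s z))%E.
Proof.
move=> s0 mf f0; have mF := measurable_affine m s.
transitivity (\int[pushforward (normal_prob 0 1) (affine m s)]_x f x)%E.
  by apply: eq_measure_integral => A mA _; exact: normal_prob_pushforward.
by rewrite ge0_integral_pushforward// preimage_setT.
Qed.

Lemma integrable_bounded01 d (T : measurableType d) (P : probability T R) (f : T -> R) :
  measurable_fun setT f -> (forall t, 0 <= f t <= 1) ->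
  P.-integrable setT (EFin \o f).
Proof.
move=> mf f01; apply: (@le_integrable _ _ _ P _ measurableT _ (EFin \o cst 1)).
- exact/measurable_EFinP.
- move=> x _ /=; rewrite lee_fin normr1; case/andP: (f01 x) => f0 f1.
  by rewrite ger0_norm.
- exact: finite_measure_integrable_cst.
Qed.

(** The density is the Radon-Nikodym derivative, by uniqueness of the latter. *)
Lemma integral_normal_density m s (f : measurableTypeR R -> R) :
  measurable_fun setT f -> (forall x, 0 <= f x <= 1) ->
  (\int[normal_prob m s]_x (f x)%:E = \int[mu]_x ((f x)%:E * (normal_pdf m s x)%:E))%E.
Proof.
move=> mf f01; have dom := normal_prob_dominates m s.
have mpdf : measurable_fun setT (EFin \o normal_pdf m s).
  by apply/measurable_EFinP; exact: measurable_normal_pdf.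
have intf := integrable_bounded01 (normal_prob m s) mf f01.
rewrite -(Radon_Nikodym_change_of_variables dom measurableT intf).
apply: ae_eq_integral => //.
- apply: emeasurable_funM; first exact/measurable_EFinP.
  by apply: (measurable_int mu); exact: Radon_Nikodym_integrable.
- by apply: emeasurable_funM => //; exact/measurable_EFinP.
- apply: ae_eqe_mul2l; apply: integral_ae_eq => //.
  + exact: Radon_Nikodym_integrable.
  + by move=> E _ mE; rewrite -Radon_Nikodym_integral.
Qed.

End NormalTransfer.

(** * The mean of a normally distributed score *)

Section NormalConvolution.
Variable R : realType.
Notation mu := (@lebesgue_measure R).
Implicit Types m s x y z t : R.

Lemma normal_peak_scale s : 0 < s -> normal_peak s = s^-1 * normal_peak 1.
Proof.
move=> s0; rewrite /normal_peak -mulrnAr sqrtrM ?sqr_ge0// sqrtr_sqr gtr0_norm//.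
by rewrite invfM expr1n mul1r.
Qed.

(** The joint density at [(z, t)] of a standard normal variable and of its sum
    with an independent normal one of mean [- delta] and deviation [rho], written
    as marginal times conditional; this is a completion of the square. *)
Lemma normal_pdf_disintegration (rho r s delta z t : R) :
  0 < rho -> 0 < r -> r ^+ 2 = rho ^+ 2 + 1 -> s = rho / r ->
  normal_pdf 0 1 z * normal_pdf (- delta) rho (t - z) =
  normal_pdf (- delta) r t * normal_pdf ((t + delta) / r ^+ 2) s z.
Proof.
move=> rho0 r0 r2 sE; have s0 : 0 < s by rewrite sE divr_gt0.
have q0 : rho ^+ 2 + 1 != 0 by rewrite -r2 sqrf_eq0 gt_eqF.
rewrite !normal_pdfE ?gt_eqF// mulrACA [RHS]mulrACA /normal_fun -!expRD.
congr (_ * expR _).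
  have h1 := normal_peak_scale rho0; have h2 := normal_peak_scale r0.
  have h3 := normal_peak_scale s0.
  rewrite h1 h2 h3; move: (normal_peak 1) => K; rewrite sE.
  by field; rewrite (gt_eqF rho0) (gt_eqF r0).
have s2 : s ^+ 2 = rho ^+ 2 / (rho ^+ 2 + 1) by rewrite sE expr_div_n r2.
rewrite s2 r2 expr1n subr0.
by field; rewrite q0 (gt_eqF rho0).
Qed.

(** [Phi ((delta - z) / rho)] is the probability that a normal variable of mean
    [z - delta] and deviation [rho] is negative.  By Tonelli, averaging over [z]
    gives the probability of ]-oo, 0] under the marginal law of
    [normal_pdf_disintegration], of mean [- delta] and variance [rho^2 + 1]. *)
Lemma integral_Phi_affine (rho delta : R) : 0 < rho ->
  (\int[normal_prob 0 1]_z (Phi ((delta - z) / rho))%:E =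
   (Phi (delta / Num.sqrt (rho ^+ 2 + 1)))%:E)%E.
Proof.
move=> rho0; set r := Num.sqrt _.
have r0 : 0 < r by rewrite sqrtr_gt0 ltr_wpDl ?sqr_ge0.
have r2 : r ^+ 2 = rho ^+ 2 + 1 by rewrite sqr_sqrtr// addr_ge0// sqr_ge0.
pose D : set (measurableTypeR R) := `]-oo, (0 : R)]%classic.
have mD : measurable D by exact: measurable_itv.
pose K (p : measurableTypeR R * measurableTypeR R) : \bar R :=
  (normal_pdf 0 1 p.1 * normal_pdf (- delta) rho (p.2 - p.1) * \1_D p.2)%:E.
have mK : measurable_fun setT K.
  apply/measurable_EFinP; apply: measurable_funM; first apply: measurable_funM.
  - by apply: (measurableT_comp (measurable_normal_pdf _ _)).
  - apply: (measurableT_comp (measurable_normal_pdf _ _)).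
    exact: measurable_funB.
  - by apply: (measurableT_comp (measurable_indic _)).
have K0 p : (0 <= K p)%E.
  by rewrite lee_fin !mulr_ge0// normal_pdf_ge0.
rewrite integral_normal_density; last 2 first.
- apply: (measurableT_comp (@measurable_Phi R)).
  by apply: measurable_funM => //; exact: measurable_funB.
- by move=> z; rewrite (ltW (Phi_gt0 _)) (ltW (Phi_lt1 _)).
transitivity (\int[mu]_z \int[mu]_t K (z, t))%E.
  apply: eq_integral => z _.
  rewrite (_ : (Phi _)%:E = normal_prob (z - delta) rho D)%E; last first.
    by rewrite normal_prob_Ny// sub0r opprB.
  rewrite /normal_prob integral_mkcond/= muleC -ge0_integralZl//.
  - apply: eq_integral => t _; rewrite /K/= patchE indicE.
    case: ifPn => tD; rewrite ?mule0 ?mulr0 ?mulr1//.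
    rewrite -EFinM; congr (_ * _)%:E.
    rewrite !normal_pdfE ?gt_eqF// /normal_fun.
    by rewrite opprB opprK [t + (_ - _)]addrA [t + _ - _]addrAC.
  - apply/(measurable_restrictT _ _).1 => //.
    by apply/measurable_EFinP; apply: measurable_funTS; exact: measurable_normal_pdf.
  - by move=> t _; rewrite patchE; case: ifPn => // _; rewrite lee_fin normal_pdf_ge0.
  - by rewrite lee_fin normal_pdf_ge0.
rewrite (fubini_tonelli K)//.
transitivity (\int[mu]_t ((normal_pdf (- delta) r t)%:E * (\1_D t)%:E))%E.
  apply: eq_integral => t _.
  transitivity (\int[mu]_z ((normal_pdf (- delta) r t * \1_D t)%:E *
      (normal_pdf ((t + delta) / r ^+ 2) (rho / r) z)%:E))%E.
    apply: eq_integral => z _; rewrite /K/=.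
    by rewrite (normal_pdf_disintegration delta z t rho0 r0 r2 erefl) mulrAC EFinM.
  rewrite ge0_integralZl//.
  - by rewrite integral_normal_pdf mule1 EFinM.
  - by apply/measurable_EFinP; exact: measurable_normal_pdf.
  - by move=> z _; rewrite lee_fin normal_pdf_ge0.
  - by rewrite lee_fin mulr_ge0// normal_pdf_ge0.
transitivity (normal_prob (- delta) r D); last first.
  by rewrite normal_prob_Ny// sub0r opprK.
rewrite /normal_prob [RHS]integral_mkcond; apply: eq_integral => t _.
by rewrite patchE indicE; case: ifPn => _; rewrite ?mule1 ?mule0.
Qed.

Lemma Rintegral_Phi_mean (rho delta : R) : 0 < rho ->
  \int[normal_prob 0 1]_z Phi ((z - delta) / rho) =
  Phi (- delta / Num.sqrt (rho ^+ 2 + 1)).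
Proof.
move=> rho0.
have mf : measurable_fun setT (fun z => Phi ((delta - z) / rho)).
  apply: (measurableT_comp (@measurable_Phi R)).
  by apply: measurable_funM => //; exact: measurable_funB.
have f01 z : 0 <= Phi ((delta - z) / rho) <= 1.
  by rewrite (ltW (Phi_gt0 _)) (ltW (Phi_lt1 _)).
transitivity (\int[normal_prob 0 1]_z (1 - Phi ((delta - z) / rho))).
  by apply: eq_Rintegral => z _; rewrite -Phi_opp -mulNr opprB.
rewrite RintegralB//=; last 2 first.
- exact: finite_measure_integrable_cst.
- exact: integrable_bounded01.
rewrite mulNr Phi_opp; congr (_ - _).
  by rewrite Rintegral_cst// mul1r -[RHS]/(fine 1%E) -(probability_setT (normal_prob 0 1)).
by rewrite /Rintegral; exact: (congr1 fine (integral_Phi_affine delta rho0)).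
Qed.

End NormalConvolution.

(** * The law of a rank under independence *)

Section IndependentThresholds.
Context d (T : measurableType d) (R : realType) (P : probability T R) (n : nat).
Variables (X : 'I_n.+1 -> {RV P >-> R}).
Hypothesis indX : mutually_independent X.
Let Y (i : 'I_n) : T -> R := X (lift ord0 i).

Lemma measurable_RV (i : 'I_n.+1) (A : set R) : measurable A -> measurable (X i @^-1` A).
Proof. by move=> mA; rewrite -[_ @^-1` _]setTI; exact: measurable_funP. Qed.

Lemma independent_head_tail (A : set R) (B : 'I_n -> set R) :
  measurable A -> (forall i, measurable (B i)) ->
  P (X ord0 @^-1` A `&` \bigcap_i (Y i @^-1` B i)) =
  (P (X ord0 @^-1` A) * \prod_i P (Y i @^-1` B i))%E.
Proof.
move=> mA mB.
pose C (j : 'I_n.+1) := if unlift ord0 j is Some i then B i else A.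
have mC j : measurable (C j) by rewrite /C; case: (unlift ord0 j).
have := indX [set: 'I_n.+1]%SET mC.
have -> : \bigcap_(i in [set` [set: 'I_n.+1]%SET]) (X i @^-1` C i) =
    X ord0 @^-1` A `&` \bigcap_i (Y i @^-1` B i).
  apply/seteqP; split => [w H|w [H0 H] j _].
    split; first by have := H ord0; rewrite /C unlift_none; apply; rewrite /= inE.
    by move=> i _; have := H (lift ord0 i); rewrite /C liftK; apply; rewrite /= inE.
  rewrite /C; case: unliftP => [i ->|->]//=; exact: H.
move=> ->; rewrite (eq_bigl predT); last by move=> i; rewrite inE.
rewrite big_ord_recl /C unlift_none; congr (_ * _)%E.
by apply: eq_bigr => i _; rewrite liftK.
Qed.

Lemma independent_tail (B : 'I_n -> set R) : (forall i, measurable (B i)) ->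
  P (\bigcap_i (Y i @^-1` B i)) = (\prod_i P (Y i @^-1` B i))%E.
Proof.
move=> mB; have := independent_head_tail measurableT mB.
by rewrite preimage_setT setTI probability_setT mul1e.
Qed.

(** The pi-system that generates the sigma-algebra of [X_1, ..., X_n]. *)
Definition cylinders : set (set T) :=
  [set C | exists2 B : 'I_n -> set R, (forall i, measurable (B i)) &
    C = \bigcap_i (Y i @^-1` B i)].

Lemma cylinders_measurable : cylinders `<=` d.-measurable.
Proof.
move=> _ [B mB ->]; apply: fin_bigcap_measurable => // i _.
exact: measurable_RV.
Qed.

Lemma setI_closed_cylinders : setI_closed cylinders.
Proof.
move=> _ _ [B mB ->] [B' mB' ->]; exists (fun i => B i `&` B' i).
  by move=> i; exact: measurableI.
by rewrite -bigcapI.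
Qed.

Lemma cylindersT : cylinders setT.
Proof.
by exists (fun=> setT) => //; apply/esym; rewrite -subTset => w _ i _.
Qed.

Lemma sub_cylinders : <<s cylinders >> `<=` d.-measurable.
Proof.
by apply: smallest_sub; [exact: sigma_algebra_measurable|exact: cylinders_measurable].
Qed.

(** For fixed [A], both sides are finite measures of [C] that agree on the
    cylinders. *)
Lemma independent_head_sigma (A : set R) (C : set T) :
  measurable A -> <<s cylinders >> C ->
  P (X ord0 @^-1` A `&` C) = (P (X ord0 @^-1` A) * P C)%E.
Proof.
move=> mA; move: C.
have mXA := measurable_RV ord0 mA.
have p0 : 0 <= fine (P (X ord0 @^-1` A)) by exact: fine_ge0.
pose m1 : {measure set T -> \bar R} := mrestr P mXA.
pose m2 : {measure set T -> \bar R} := mscale (NngNum p0) P.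
have m1E C : m1 C = P (X ord0 @^-1` A `&` C).
  by rewrite -[LHS]/(P (C `&` X ord0 @^-1` A)) setIC.
have m2E C : m2 C = (P (X ord0 @^-1` A) * P C)%E.
  by rewrite -[LHS]/((fine (P (X ord0 @^-1` A)))%:E * P C)%E fineK// fin_num_measure.
move=> C sC; rewrite -m1E -m2E; move: C sC.
apply: (@g_sigma_algebra_measure_unique _ _ _ cylinders cylinders_measurable (fun=> setT)).
- by move=> i; exact: cylindersT.
- by apply/seteqP; split => // w _; exists 0%N.
- exact: setI_closed_cylinders.
- move=> C [B mB CE]; rewrite CE m1E m2E.
  by rewrite independent_head_tail// independent_tail.
- by move=> k; rewrite -ge0_fin_numE// fin_num_measure.
Qed.


Let T' := g_sigma_algebraType cylinders.

Lemma measurable_to_cylinders : measurable_fun setT (id : T -> T').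
Proof.
move=> _ B mB; rewrite setTI; exact: sub_cylinders.
Qed.

(** The map [w |-> (X_0 w, w)] sends [P] to the product of the law of [X_0] and
    of the restriction of [P] to the sigma-algebra of [X_1, ..., X_n]: by
    [independent_head_sigma] they agree on rectangles.  The integral is then
    the definition of the product measure through sections. *)
Lemma conditioning_on_head (nu : probability (measurableTypeR R) R)
    (S : set (measurableTypeR R * T')) :
  (forall A, measurable A -> P (X ord0 @^-1` A) = nu A) -> measurable S ->
  P [set w | S (X ord0 w, w)] = (\int[nu]_x P [set w | S (x, w)])%E.
Proof.
move=> X0nu mS.
pose h (w : T) : measurableTypeR R * T' := (X ord0 w, w).
have mh : measurable_fun setT h.
  apply: measurable_fun_pair; last exact: measurable_to_cylinders.
  by move=> _ A mA; rewrite setTI; exact: measurable_RV.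
pose Q : {measure set (measurableTypeR R * T') -> \bar R} := pushforward P h.
pose idT (w : T) : T' := w.
have mid : measurable_fun setT idT := measurable_to_cylinders.
pose idRV : {mfun T >-> T'} := mfun_Sub (mem_set mid).
pose P' : probability T' R := distribution P idRV.
rewrite -[LHS]/(Q mh S) -(@product_measure_unique _ _ _ _ _ nu P' (Q mh) _ S mS).
  by apply: eq_integral => x _; congr (P _); apply/seteqP; split => w; rewrite /xsection/= inE.
move=> A B mA mB.
rewrite -[LHS]/(P (X ord0 @^-1` A `&` B)).
by rewrite independent_head_sigma// X0nu.
Qed.

Lemma measurable_tail_cylinders i : measurable_fun setT (Y i : T' -> measurableTypeR R).
Proof.
move=> _ A mA; rewrite setTI; apply: sub_sigma_algebra.
exists (fun j => if j == i then A else setT) => [j|]; first by case: ifP.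
apply/seteqP; split => [w Aw j _ /=|w /(_ i I)]; last by rewrite eqxx.
by case: eqVneq => [->|].
Qed.

Definition count_le (x : R) (w : T) : nat := (\sum_(i < n) (Y i w <= x)%R)%N.

Lemma count_leE x w (J : {set 'I_n}) :
  (forall i, (Y i w <= x)%R = (i \in J)) <-> J = [set i | (Y i w <= x)%R]%SET.
Proof.
split => [H|-> i]; last by rewrite inE.
by apply/setP => i; rewrite inE H.
Qed.

Lemma card_count_le x w : count_le x w = #|[set i | (Y i w <= x)%R]%SET|.
Proof.
rewrite /count_le -sum1dep_card [RHS]big_mkcond; apply: eq_bigr => i _.
by case: (_ <= _).
Qed.

Lemma measurable_count_le m : measurable
  [set p : measurableTypeR R * T' | count_le p.1 p.2 = m].
Proof.
have -> : [set p : measurableTypeR R * T' | count_le p.1 p.2 = m] =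
    \bigcup_(J in [set J : {set 'I_n} | #|J| = m]) \bigcap_i
      ((fun p : measurableTypeR R * T' => (Y i p.2 <= p.1)%R) @^-1` [set i \in J]).
  apply/seteqP; split => [p /= pm|p [J /= Jm H] /=].
    exists [set i | (Y i p.2 <= p.1)%R]%SET; first by rewrite /= -card_count_le.
    by move=> i _ /=; rewrite inE.
  rewrite card_count_le -Jm; congr #|pred_of_set _|; apply/esym/count_leE => i.
  exact: (H i I).
apply: fin_bigcup_measurable => //.
move=> J _; apply: fin_bigcap_measurable => // i _.
rewrite -[X in measurable X]setTI.
have mf : measurable_fun setT (fun p : measurableTypeR R * T' => (Y i p.2 <= p.1)%R).
  apply: measurable_fun_ler; last exact: measurable_fst.
  apply: (@measurableT_comp _ _ _ _ _ _ (Y i : T' -> measurableTypeR R)).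
    exact: measurable_tail_cylinders.
  exact: measurable_snd.
by apply: mf.
Qed.

(** The event is the disjoint union, over the sets [J] of [m] indices, of the
    cylinders on which exactly the [X_i] with [i] in [J] are at most [x]. *)
Lemma count_le_binomial (x F : R) m : (m <= n)%N ->
  (forall i, P (Y i @^-1` `]-oo, x]) = F%:E) ->
  P [set w | count_le x w = m] = ('C(n, m)%:R * (F ^+ m * (1 - F) ^+ (n - m)))%:E.
Proof.
move=> mn PF.
pose B (J : {set 'I_n}) i : set R := if i \in J then `]-oo, x]%classic else ~` `]-oo, x]%classic.
have mB J i : measurable (B J i) by rewrite /B; case: ifP => _ //; exact: measurableC.
pose E J := \bigcap_i (Y i @^-1` B J i).
have mE J : measurable (E J) by apply: cylinders_measurable; exists (B J).
have EP J w : (w \in E J) = (J == [set i | (Y i w <= x)%R]%SET).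
  apply/idP/eqP.
    rewrite inE => H; apply/count_leE => i; have := H i I.
    by rewrite /B; case: ifP => _ /=; rewrite in_itv/= => // /negP/negbTE.
  move/count_leE => H; rewrite inE => i _; rewrite /B /=.
  by case: ifPn => iJ /=; rewrite in_itv/= H// (negbTE iJ).
have PE J : P (E J) = (F ^+ #|J| * (1 - F) ^+ (n - #|J|))%:E.
  rewrite independent_tail//.
  rewrite (eq_bigr (fun i => (if i \in J then F else 1 - F)%:E)); last first.
    move=> i _; rewrite /B; case: ifP => _; first exact: PF.
    have mle : measurable (Y i @^-1` `]-oo, x]) := measurable_RV (lift ord0 i) (measurable_itv _).
    by rewrite preimage_setC (probability_setC P mle) PF.
  rewrite prodEFin; congr EFin.
  rewrite (bigID (mem J))/= (eq_bigr (fun=> F)); last by move=> i ->.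
  rewrite [X in _ * X](eq_bigr (fun=> 1 - F)); last by move=> i /negbTE ->.
  have cJ : #|[predC J]| = (n - #|J|)%N.
    by rewrite -(addKn #|J| #|[predC J]|) cardC card_ord.
  rewrite prodr_const -cJ -[(1 - F) ^+ _]prodr_const; congr (_ * _).
have -> : P [set w | count_le x w = m] =
    (\sum_(J : {set 'I_n} | #|J| == m) P (E J))%E.
  have mS : measurable [set w | count_le x w = m].
    have -> : [set w | count_le x w = m] =
        \bigcup_(J in [set J : {set 'I_n} | #|J| = m]) E J.
      apply/seteqP; split => [w /= wm|w [J /= Jm]].
        exists [set i | (Y i w <= x)%R]%SET; first by rewrite /= -card_count_le.
        by apply/set_mem; rewrite EP.
      by move=> /mem_set; rewrite EP /= card_count_le -Jm => /eqP <-.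
    exact: fin_bigcup_measurable.
  rewrite -[X in P X = _]setIT -integral_indic//.
  transitivity (\int[P]_w (\sum_(J : {set 'I_n} | #|J| == m) (\1_(E J) w)%:E))%E.
    apply: eq_integral => w _; rewrite sumEFin; congr EFin.
    under eq_bigr => J _ do rewrite indicE EP.
    rewrite indicE; case: (boolP (w \in _)) => [|/negP wS].
      rewrite inE/= card_count_le => wm.
      rewrite (bigD1 [set i | (Y i w <= x)%R]%SET) ?wm//= eqxx big1 ?addr0//.
      by move=> J /andP[_ /negbTE ->].
    rewrite big1// => J /eqP Jm; case: eqP => // JE.
    by exfalso; apply: wS; rewrite inE/= card_count_le -JE.
  under eq_integral do rewrite -big_filter.
  rewrite -[RHS]big_filter ge0_integral_sum//; last first.
    by move=> J; apply/measurable_EFinP; exact: measurable_indic.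
  by apply: eq_bigr => J _; rewrite integral_indic// setIT.
rewrite (eq_bigr (fun=> (F ^+ m * (1 - F) ^+ (n - m))%:E)); last first.
  by move=> J /eqP <-; exact: PE.
rewrite sumEFin sumr_const; congr EFin.
by rewrite -[in RHS](card_ord n) -card_draws mulr_natl cardsE card_ord.
Qed.

End IndependentThresholds.

(** * The score of the sample *)

Section StandardizedFunctional.
Variable R : realType.
Implicit Types (rho delta : R) (p : {poly R}).

(** The score [Phi ((X_0 - mu) / sigma)] as a function of the standardized
    [z = (X_0 - mu_0) / sigma_0]; see [sample_score]. *)
Definition zscore rho delta (z : measurableTypeR R) : R := Phi ((z - delta) / rho).

Definition zmean rho delta : {poly R} -> R :=
  weighted_integral (normal_prob 0 1) setT (zscore rho delta) (cst 1).

Lemma measurable_zscore rho delta : measurable_fun setT (zscore rho delta).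
Proof.
apply: (measurableT_comp (@measurable_Phi R)).
by apply: measurable_funM => //; exact: measurable_funB.
Qed.

Lemma zscore_gt0 rho delta z : 0 < zscore rho delta z.
Proof. exact: Phi_gt0. Qed.

Lemma zscore_lt1 rho delta z : zscore rho delta z < 1.
Proof. exact: Phi_lt1. Qed.

Lemma zscore01 rho delta z : 0 <= zscore rho delta z <= 1.
Proof. by rewrite !ltW ?zscore_gt0 ?zscore_lt1. Qed.

Lemma zmeanE rho delta p :
  zmean rho delta p = \int[normal_prob 0 1]_z p.[zscore rho delta z].
Proof. by apply: eq_Rintegral => z _; rewrite mulr1. Qed.

Lemma zmean1 rho delta : zmean rho delta 1 = 1.
Proof.
rewrite zmeanE (_ : \int[_]_z _ = \int[normal_prob 0 1]_(z in setT) (1 : R)).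
  by rewrite Rintegral_cst// mul1r -[RHS]/(fine 1%E) -(probability_setT (normal_prob 0 1)).
by apply: eq_Rintegral => z _; rewrite hornerC.
Qed.

Lemma integrable_zmean rho delta p :
  (normal_prob 0 1).-integrable setT (EFin \o (fun z => p.[zscore rho delta z])).
Proof.
have := @integrable_weighted _ _ R (normal_prob 0 1) setT (zscore rho delta) (cst 1)
  measurableT (measurable_zscore rho delta) (fun z _ => zscore01 rho delta z)
  (finite_measure_integrable_cst _ _ measurableT) p.
by rewrite (_ : (fun x => _) = (fun z => p.[zscore rho delta z]))//;
  apply/funext => z; rewrite mulr1.
Qed.

Lemma zmean_functional rho delta : moment_functional (zmean rho delta).
Proof.
have := @weighted_integral_functional _ _ R (normal_prob 0 1) setT (zscore rho delta) (cst 1)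
  measurableT (measurable_zscore rho delta) (fun z _ => zscore01 rho delta z)
  (fun _ _ => ler01) (finite_measure_integrable_cst _ _ measurableT).
rewrite -[weighted_integral _ _ _ _ 1]/(zmean rho delta 1) zmean1 => /(_ ltr01).
by move=> [D Z _ G]; split=> [p q|c p||p /G]; rewrite ?zmean1//; [have := D p q|have := Z c p|];
  rewrite !divr1.
Qed.

Lemma zmeanX rho delta : 0 < rho ->
  zmean rho delta 'X = Phi (- delta / Num.sqrt (rho ^+ 2 + 1)).
Proof.
move=> rho0; rewrite zmeanE -Rintegral_Phi_mean//.
by apply: eq_Rintegral => z _; rewrite hornerX.
Qed.

Lemma zmean_gt0 rho delta p (x y : R) : x < y ->
  (forall u, 0 <= u <= 1 -> 0 <= p.[u]) ->
  (forall z, x < z <= y -> 0 < p.[zscore rho delta z]) -> 0 < zmean rho delta p.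
Proof.
move=> xy p0 pE; rewrite zmeanE.
apply: (@Rintegral_gt0 _ _ R _ setT (`]x, y]%classic : set (measurableTypeR R))) => //.
- exact: integrable_zmean.
- by move=> z _; apply: p0; exact: zscore01.
- rewrite (_ : _ `]x, y]%classic = (Phi y - Phi x)%:E); last exact: (Phi_itv (ltW xy)).
  by rewrite eqe gt_eqF// subr_gt0 Phi_lt.
Qed.

Lemma zmean_q_gt0 rho delta : 0 < zmean rho delta ('X * (1 - 'X)).
Proof.
apply: (@zmean_gt0 _ _ _ 0 1) => // [u /andP[u0 u1]|z _].
  by rewrite !hornerE mulr_ge0// subr_ge0.
by rewrite !hornerE mulr_gt0 ?zscore_gt0// subr_gt0 zscore_lt1.
Qed.

Lemma zscore_lt rho delta y z : 0 < rho -> y < z -> zscore rho delta y < zscore rho delta z.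
Proof. by move=> rho0 yz; rewrite Phi_lt// ltr_pM2r ?invr_gt0// ltrD2r. Qed.

(** The score is strictly increasing, so it avoids [c] on ]0, 1] or on ]-1, 0],
    according to the position of its value at 0. *)
Lemma zmean_sqr_gt0 rho delta c : 0 < rho -> 0 < zmean rho delta (('X - c%:P) ^+ 2).
Proof.
move=> rho0.
have sq u : (('X - c%:P) ^+ 2).[u] = (u - c) ^+ 2 by rewrite horner_exp hornerXsubC.
have [c0|c0] := leP c (zscore rho delta 0).
  apply: (@zmean_gt0 _ _ _ 0 1) => // [u _|z /andP[z0 _]]; rewrite sq ?sqr_ge0//.
  rewrite exprn_even_gt0//= subr_eq0 gt_eqF// (le_lt_trans c0)//.
  exact: zscore_lt.
apply: (@zmean_gt0 _ _ _ (-1) 0) => // [u _|z /andP[_ z0]]; rewrite sq ?sqr_ge0//.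
rewrite exprn_even_gt0//= subr_eq0 lt_eqF// (le_lt_trans _ c0)//.
by move: z0; rewrite le_eqVlt => /predU1P[->//|z0]; rewrite ltW// zscore_lt.
Qed.

End StandardizedFunctional.

Section SampleLaw.
Variables (R : realType) (n : nat) (M : normal_sample R n).
Local Notation rho := (ns_rho M).
Local Notation delta := (ns_delta M).

Lemma ns_rho_gt0 : 0 < rho.
Proof. by rewrite divr_gt0 ?ns_sigma_gt0 ?ns_sigma0_gt0. Qed.

Lemma sample_score z :
  Phi ((affine (ns_mu0 M) (ns_sigma0 M) z - ns_mu M) / ns_sigma M) = zscore rho delta z.
Proof.
rewrite /zscore /affine /ns_rho /ns_delta; congr Phi; field.
by rewrite (gt_eqF (ns_sigma0_gt0 M)) (gt_eqF (ns_sigma_gt0 M)).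
Qed.

Let score (x : measurableTypeR R) : R := Phi ((x - ns_mu M) / ns_sigma M).

Lemma measurable_sample_score : measurable_fun setT score.
Proof.
apply: (measurableT_comp (@measurable_Phi R)).
by apply: measurable_funM => //; exact: measurable_funB.
Qed.

Lemma measurable_poly_score (p : {poly R}) : measurable_fun setT (fun x => p.[score x]).
Proof.
apply: (measurableT_comp _ measurable_sample_score).
by apply: continuous_measurable_fun; exact: continuous_horner.
Qed.

Lemma ge0_integral_poly_score (p : {poly R}) :
  (forall u, 0 <= u <= 1 -> 0 <= p.[u]) ->
  (\int[normal_prob (ns_mu0 M) (ns_sigma0 M)]_x (p.[score x])%:E =
   (zmean rho delta p)%:E)%E.
Proof.
move=> p0.
rewrite (@ge0_integral_normal_affine _ _ _ (fun x => (p.[score x])%:E) (ns_sigma0_gt0 M)).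
- under eq_integral do rewrite /score sample_score.
  rewrite zmeanE /Rintegral fineK//.
  exact: (integrable_fin_num _ (integrable_zmean rho delta p)).
- by apply/measurable_EFinP; exact: measurable_poly_score.
- by move=> x; rewrite lee_fin p0// !ltW ?Phi_gt0 ?Phi_lt1.
Qed.

Lemma law_head (A : set R) : measurable A ->
  ns_prob M (ns_rv M ord0 @^-1` A) = normal_prob (ns_mu0 M) (ns_sigma0 M) A.
Proof. by move=> mA; exact: (@ns_law0 _ _ M A mA). Qed.

Lemma law_tail (i : 'I_n) (x : R) :
  ns_prob M (ns_rv M (lift ord0 i) @^-1` `]-oo, x]) =
  (Phi ((x - ns_mu M) / ns_sigma M))%:E.
Proof.
rewrite -(normal_prob_Ny _ _ (ns_sigma_gt0 M)).
by apply: (@ns_law _ _ M i); exact: measurable_itv.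
Qed.

Lemma integral_poly_Z (p : {poly R}) : (forall u, 0 <= u <= 1 -> 0 <= p.[u]) ->
  (\int[ns_prob M]_w (p.[Z w])%:E = (zmean rho delta p)%:E)%E.
Proof.
move=> p0; rewrite -ge0_integral_poly_score//.
pose X0 (w : ns_space M) : measurableTypeR R := ns_rv M ord0 w.
have mX0 : measurable_fun setT X0.
  by move=> _ A mA; rewrite setTI; exact: measurable_RV.
transitivity (\int[pushforward (ns_prob M) X0]_x (p.[score x])%:E)%E.
  rewrite ge0_integral_pushforward//.
  - by apply/measurable_EFinP; exact: measurable_poly_score.
  - by move=> x _; rewrite lee_fin p0// !ltW ?Phi_gt0 ?Phi_lt1.
by apply: eq_measure_integral => A mA _; exact: law_head.
Qed.

Lemma expectation_Z : ('E_(ns_prob M)[@Z R n M] = (zmean rho delta 'X)%:E)%E.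
Proof.
rewrite unlock -integral_poly_Z; last by move=> u /andP[]; rewrite hornerX.
by apply: eq_integral => w _; rewrite hornerX.
Qed.

Lemma meanZE : meanZ M = zmean rho delta 'X.
Proof. by rewrite zmeanX ?ns_rho_gt0. Qed.

Lemma varZE : varZ M =
  zmean rho delta 'X * (1 - zmean rho delta 'X) - zmean rho delta ('X * (1 - 'X)).
Proof.
set m := zmean rho delta 'X.
rewrite /varZ /variance unlock expectation_Z unlock.
transitivity (fine (\int[ns_prob M]_w (('X - m%:P) ^+ 2).[Z w]%:E)%E).
  congr fine; apply: eq_integral => w _.
  by rewrite horner_exp hornerXsubC expr2.
rewrite integral_poly_Z/=; last by move=> u _; rewrite horner_exp sqr_ge0.
rewrite (moment_functional_variance (zmean_functional rho delta)).
by rewrite subrr expr0n/= addr0.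
Qed.

Lemma varZ_gt0 : 0 < varZ M.
Proof.
have := zmean_sqr_gt0 delta (zmean rho delta 'X) ns_rho_gt0.
rewrite (moment_functional_variance (zmean_functional rho delta)).
by rewrite subrr expr0n/= addr0 -varZE.
Qed.

Lemma ns_rank_prob0 k : (k == 0)%N || (n.+1 < k)%N -> ns_rank_prob M k = 0.
Proof.
move=> kn; rewrite /ns_rank_prob (_ : [set w | _] = set0) ?measure0//.
rewrite -subset0 => w /=; rewrite /ns_rank => rk.
have : (\sum_(i < n) (ns_rv M (lift ord0 i) w <= ns_rv M ord0 w)%R <= n)%N.
  rewrite -[leqRHS]card_ord -sum1_card; apply: leq_sum => i _; exact: leq_b1.
by move: kn; rewrite -rk add1n ltnS ltnNge /= => /negbTE ->.
Qed.

(** Given [X_0 = x], the number of [X_i] below [x] is binomial with parameter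
    the score of [x]. *)
Lemma ns_rank_probE k : (1 <= k <= n.+1)%N ->
  ns_rank_prob M k =
  'C(n, k - 1)%:R * zmean rho delta (bernstein (k - 1) (n - (k - 1))).
Proof.
case: k => // m; rewrite subn1 /= ltnS => mn.
rewrite /ns_rank_prob.
have -> : [set w | ns_rank w = m.+1] =
    [set w | count_le (ns_rv M) (ns_rv M ord0 w) w = m].
  apply/seteqP; split => w /=; rewrite /ns_rank add1n; first by case.
  by rewrite /count_le => ->.
have cond := @conditioning_on_head _ _ _ _ _ _ (@ns_indep _ _ M)
  (normal_prob (ns_mu0 M) (ns_sigma0 M)) _ law_head (@measurable_count_le _ _ _ _ _ (ns_rv M) m).
apply: (etrans (congr1 fine cond)).
transitivity (fine (\int[normal_prob (ns_mu0 M) (ns_sigma0 M)]_x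
    (('C(n, m)%:R *: bernstein m (n - m)).[score x])%:E)%E).
  congr fine; apply: eq_integral => x _ /=.
  rewrite (@count_le_binomial _ _ _ _ _ _ (@ns_indep _ _ M) x (score x) m mn).
    by rewrite hornerZ bernsteinE.
  by move=> i; exact: law_tail.
have [_ Z _ _] := zmean_functional rho delta.
rewrite ge0_integral_poly_score ?Z// => u /andP[u0 u1].
by rewrite hornerZ bernsteinE !mulr_ge0// exprn_ge0// subr_ge0.
Qed.

End SampleLaw.

(** * The beta law with the same mean and variance *)

Section BetaMatch.
Variables (R : realType) (n : nat) (M : normal_sample R n).
Local Notation rho := (ns_rho M).
Local Notation delta := (ns_delta M).
Let p := zmean rho delta 'X.
Let q := zmean rho delta ('X * (1 - 'X)).
Let V := varZ M.
Let a := beta_a M.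
Let b := beta_b M.

Lemma meanZ_gt0 : 0 < p.
Proof. by rewrite /p zmeanX ?ns_rho_gt0// Phi_gt0. Qed.

Lemma meanZ_lt1 : p < 1.
Proof. by rewrite /p zmeanX ?ns_rho_gt0// Phi_lt1. Qed.

Lemma varZ_compl : p * (1 - p) - V = q.
Proof. by rewrite /V varZE; exact: subKr. Qed.

Lemma beta_aE : a = p * q / V.
Proof. by rewrite /a /beta_a meanZE varZ_compl. Qed.

Lemma beta_bE : b = (1 - p) * q / V.
Proof. by rewrite /b /beta_b meanZE varZ_compl. Qed.

Lemma beta_a_gt0 : 0 < a.
Proof. by rewrite beta_aE divr_gt0 ?varZ_gt0// mulr_gt0 ?meanZ_gt0// zmean_q_gt0. Qed.

Lemma beta_b_gt0 : 0 < b.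
Proof.
rewrite beta_bE divr_gt0 ?varZ_gt0// mulr_gt0 ?zmean_q_gt0//.
by rewrite subr_gt0 meanZ_lt1.
Qed.

Definition beta_mean (r : {poly R}) : R := beta_integral a b r / beta_integral a b 1.

Lemma beta_mean_functional : moment_functional beta_mean.
Proof. exact: beta_integral_functional beta_a_gt0 beta_b_gt0. Qed.

Lemma beta_meanX : beta_mean 'X = p.
Proof.
have B1 := beta_integral_gt0 beta_a_gt0 beta_b_gt0.
rewrite /beta_mean beta_integralX ?beta_a_gt0 ?beta_b_gt0// mulfK ?gt_eqF//.
have V0 : 0 < V := varZ_gt0 M; have q0 : 0 < q := zmean_q_gt0 rho delta.
rewrite beta_aE beta_bE; clearbody p q V.
have -> : p * q / V + (1 - p) * q / V = q / V by ring.
by field; rewrite (gt_eqF V0) (gt_eqF q0).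
Qed.

(** Here [a + b = q / V] and [a + b + 1 = p (1 - p) / V]. *)
Lemma beta_meanX1X : beta_mean ('X * (1 - 'X)) = q.
Proof.
have B1 := beta_integral_gt0 beta_a_gt0 beta_b_gt0.
rewrite /beta_mean beta_integralX1X ?beta_a_gt0 ?beta_b_gt0// mulfK ?gt_eqF//.
have V0 : 0 < V := varZ_gt0 M; have q0 : 0 < q := zmean_q_gt0 rho delta.
have p0 := meanZ_gt0; have p1 := meanZ_lt1.
have qE : q = p * (1 - p) - V by rewrite varZ_compl.
rewrite beta_aE beta_bE; clearbody p q V.
have -> : p * q / V + (1 - p) * q / V = q / V by ring.
have -> : q / V + 1 = p * (1 - p) / V by rewrite qE; field; rewrite gt_eqF.
have p1' : 1 - p != 0 by rewrite subr_eq0 gt_eqF.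
by field; rewrite (gt_eqF V0) (gt_eqF q0) (gt_eqF p0) p1'.
Qed.

Lemma beta_binomial_probE k : (1 <= k <= n.+1)%N ->
  beta_binomial_prob M k =
  'C(n, k - 1)%:R * beta_mean (bernstein (k - 1) (n - (k - 1))).
Proof.
case: k => // m; rewrite subn1 /= ltnS => mn.
rewrite /beta_binomial_prob subn1 /= /beta_mean -!/a -!/b.
have B1 : Beta a b = beta_integral a b 1.
  have := BetaE beta_a_gt0 beta_b_gt0 0 0.
  by rewrite !addr0 /bernstein !expr0 mulr1.
have ea (c : R) : c + m.+1%:R - 1 = c + m%:R by rewrite -natr1 addrA addrK.
have eb (c : R) : c + n%:R + 1 - m.+1%:R = c + (n - m)%:R.
  by rewrite natrB// -natr1; ring.
by rewrite ea eb (BetaE beta_a_gt0 beta_b_gt0) B1.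
Qed.

Lemma rank_prob_error_q k : (1 <= n)%N -> (1 <= k <= n.+1)%N ->
  `|ns_rank_prob M k - beta_binomial_prob M k| <= 'C(n, k - 1)%:R * (2 * (n%:R * q)).
Proof.
move=> n1 kn; rewrite ns_rank_probE// beta_binomial_probE// -mulrBr normrM ger0_norm//.
rewrite ler_wpM2l//; have kn' : (k - 1 + (n - (k - 1)) = n)%N.
  by rewrite subnKC// leq_subLR add1n; case/andP: kn.
have := bernstein_compare_chord (zmean_functional rho delta) beta_mean_functional
  (esym beta_meanX) (esym beta_meanX1X) (i := k - 1) (j := n - (k - 1)).
by rewrite kn'; exact.
Qed.

Lemma rank_prob_error_V k : (1 <= k <= n.+1)%N ->
  `|ns_rank_prob M k - beta_binomial_prob M k| <=
  'C(n, k - 1)%:R * (4 * (n%:R * Num.sqrt V)).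
Proof.
move=> kn; rewrite ns_rank_probE// beta_binomial_probE// -mulrBr normrM ger0_norm//.
rewrite ler_wpM2l//; have kn' : (k - 1 + (n - (k - 1)) = n)%N.
  by rewrite subnKC// leq_subLR add1n; case/andP: kn.
rewrite /V varZE.
have := bernstein_compare_variance (zmean_functional rho delta) beta_mean_functional
  (esym beta_meanX) (esym beta_meanX1X) (k - 1) (n - (k - 1)).
by rewrite kn'.
Qed.

End BetaMatch.

(** * The limits *)

Section VarianceLimits.
Variable R : realType.
Implicit Types (rho delta : R).

Definition zvar rho delta : R :=
  zmean rho delta 'X * (1 - zmean rho delta 'X) - zmean rho delta ('X * (1 - 'X)).

Lemma zmean_split rho delta (p : {poly R}) (A : set (measurableTypeR R)) (e : R) :
  measurable A -> (forall u, 0 <= u <= 1 -> p.[u] <= 1) -> 0 <= e ->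
  (forall z, ~ A z -> p.[zscore rho delta z] <= e) ->
  zmean rho delta p <= fine (normal_prob 0 1 A) + e.
Proof.
move=> mA p1 e0 pe; rewrite zmeanE.
have iA : (normal_prob 0 1).-integrable setT (EFin \o (\1_A : measurableTypeR R -> R)).
  apply: integrable_bounded01; first exact: measurable_indic.
  by move=> z; rewrite indicE; case: (_ \in _); rewrite /= ?lexx ?ler01.
have ie : (normal_prob 0 1).-integrable setT (EFin \o (cst e : measurableTypeR R -> R)).
  exact: finite_measure_integrable_cst.
have iAe : (normal_prob 0 1).-integrable setT
    (EFin \o (fun z : measurableTypeR R => \1_A z + e)).
  by have := integrableD measurableT iA ie.
apply: (@le_trans _ _ (\int[normal_prob 0 1]_(z in setT) (\1_A z + e))).
  apply: le_Rintegral => //; first exact: integrable_zmean.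
  move=> z _; rewrite indicE; case: (boolP (z \in A)) => zA /=.
    by rewrite (@le_trans _ _ 1)// ?lerDl// p1// zscore01.
  by rewrite add0r pe// => /mem_set; exact/negP.
rewrite RintegralD// lerD//.
  by rewrite /Rintegral integral_indic// setIT.
rewrite Rintegral_cst// -[leRHS]mulr1 ler_wpM2l//.
by rewrite -[leRHS]/(fine 1%E) -(probability_setT (normal_prob 0 1)).
Qed.

(** Off the event [|z| > r], of probability [2 Phi (- r)], the score is within
    [normal_peak 1 * (r / rho)] of [Phi (- delta / rho)], because [Phi] is
    Lipschitz.  The bound does not depend on [delta]. *)
Lemma zvar_le_spread rho delta (r : R) : 0 < rho -> 0 <= r ->
  zvar rho delta <= 2 * Phi (- r) + (normal_peak 1 * (r / rho)) ^+ 2.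
Proof.
move=> rho0 r0; pose c := Phi (- delta / rho) : R.
have := moment_functional_variance (zmean_functional rho delta) c.
rewrite -/(zvar rho delta) => E.
apply: (@le_trans _ _ (zmean rho delta (('X - c%:P) ^+ 2))).
  by rewrite E lerDl sqr_ge0.
have c01 : 0 <= c <= 1 by rewrite !ltW ?Phi_gt0 ?Phi_lt1.
pose B : set (measurableTypeR R) := `](- r), r]%classic.
have mB : measurable B by exact: measurable_itv.
have -> : 2 * Phi (- r) = fine (normal_prob 0 1 (~` B)).
  have rr : - r <= r by lra.
  have BE : normal_prob 0 1 B = (Phi r - Phi (- r))%:E := Phi_itv rr.
  have -> : normal_prob 0 1 (~` B) = (1 - (Phi r - Phi (- r))%:E)%E.
    by rewrite -BE; exact: (probability_setC (normal_prob 0 1) mB).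
  by rewrite /= (Phi_opp r); ring.
apply: zmean_split.
- exact: measurableC.
- by move=> u /andP[u0 u1]; case/andP: c01 => c0 c1; rewrite horner_exp hornerXsubC; nra.
- exact: sqr_ge0.
move=> z /contrapT; rewrite /B/= in_itv/= => /andP[zr1 zr2].
rewrite horner_exp hornerXsubC -real_normK ?num_real//.
rewrite ler_sqr ?nnegrE ?mulr_ge0 ?normal_peak_ge0 ?divr_ge0 ?(ltW rho0)//.
rewrite (le_trans (Phi_lipschitz _ _))// ler_wpM2l ?normal_peak_ge0//.
rewrite -mulrBl opprK subrK normrM [X in _ * X]gtr0_norm ?invr_gt0//.
  by rewrite ler_wpM2r ?invr_ge0 ?(ltW rho0)// ler_norml (ltW zr1).
by rewrite invr_ge0 ltW.
Qed.

(** Off the interval of radius [eta] around [delta], the score or its complement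
    is at most [Phi (- eta / rho)], hence so is their product. *)
Lemma zmean_q_le rho delta (eta : R) : 0 < rho -> 0 <= eta ->
  zmean rho delta ('X * (1 - 'X)) <= normal_peak 1 * (2 * eta) + Phi (- eta / rho).
Proof.
move=> rho0 eta0.
pose B : set (measurableTypeR R) := `](delta - eta), (delta + eta)]%classic.
have mB : measurable B by exact: measurable_itv.
apply: (@le_trans _ _ (fine (normal_prob 0 1 B) + Phi (- eta / rho))).
  apply: zmean_split => //; last 2 first.
  - by rewrite ltW// Phi_gt0.
  - move=> z Bz; rewrite !hornerE.
    have /andP[z0 z1] := zscore01 rho delta z.
    have [zd|zd] := leP z (delta - eta).
      rewrite (@le_trans _ _ (zscore rho delta z))//.
        by rewrite ler_piMr// gerBl.
      by rewrite /zscore Phi_le// ler_pM2r ?invr_gt0// lerBlDr addrC.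
    have zd' : delta + eta < z.
      by rewrite ltNge; apply/negP => h; apply: Bz; rewrite /B/= in_itv/= zd.
    rewrite (@le_trans _ _ (1 - zscore rho delta z))//.
      by rewrite ler_piMl// subr_ge0.
    by rewrite /zscore -Phi_opp Phi_le// -mulNr ler_pM2r ?invr_gt0// lerN2 lerBrDl ltW.
  - by move=> u /andP[u0 u1]; rewrite !hornerE; nra.
rewrite lerD2r; have dd : delta - eta <= delta + eta by lra.
have -> : normal_prob 0 1 B = (Phi (delta + eta) - Phi (delta - eta))%:E := Phi_itv dd.
rewrite /= (le_trans (ler_norm _))// (le_trans (Phi_lipschitz _ _))//.
rewrite ler_wpM2l ?normal_peak_ge0// ger0_norm; lra.
Qed.

Lemma zvar_ge0 rho delta : 0 < rho -> 0 <= zvar rho delta.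
Proof.
move=> rho0; have := zmean_sqr_gt0 delta (zmean rho delta 'X) rho0.
rewrite (moment_functional_variance (zmean_functional rho delta)).
by rewrite subrr expr0n/= addr0 => /ltW.
Qed.

(** [V <= p (1 - p)], and one of [p], [1 - p] is the right-hand side. *)
Lemma zvar_le_tail rho delta : 0 < rho ->
  zvar rho delta <= Phi (- (`|delta| / Num.sqrt (rho ^+ 2 + 1))).
Proof.
move=> rho0; rewrite /zvar zmeanX//; set r := Num.sqrt _.
apply: (@le_trans _ _ (Phi (- delta / r) * (1 - Phi (- delta / r)))).
  by rewrite gerBl ltW// zmean_q_gt0.
have [d0|d0] := leP 0 delta.
  rewrite ger0_norm// -mulNr ler_piMr ?(ltW (Phi_gt0 _))// gerBl.
  by rewrite ltW ?Phi_gt0.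
rewrite ltr0_norm// -Phi_opp.
by rewrite ler_piMl ?ltW ?Phi_gt0 ?Phi_lt1.
Qed.

Lemma Phi_small (e : R) : 0 < e -> exists2 y : R, 0 < y & forall x, y <= x -> Phi (- x) < e.
Proof.
move=> e0; have /cvgr0Pnorm_lt /(_ _ e0) := @Phi_cvgNy R.
move=> [y [_ Hy]]; exists (Num.max 1 (1 - y)); first by rewrite lt_max ltr01.
move=> x; rewrite ge_max => /andP[_ x1].
have := Hy (- x); rewrite ger0_norm; last by rewrite ltW// Phi_gt0.
by apply; lra.
Qed.

(** The mean shift [delta] may vary with [rho] in any way. *)
Lemma zvar_cvg_pinfty (delta : R -> R) : zvar rho (delta rho) @[rho --> +oo] --> (0 : R).
Proof.
apply/cvgr0Pnorm_le => e e0.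
have e4 : 0 < e / 4 by rewrite divr_gt0.
have e2 : 0 < e / 2 by rewrite divr_gt0.
have [r r0 Hr] := Phi_small e4.
pose K : R := normal_peak 1 * r.
have K0 : 0 <= K by rewrite mulr_ge0 ?normal_peak_ge0// ltW.
near=> rho.
have rho0 : 0 < rho by near: rho; exact: nbhs_pinfty_gt.
rewrite ger0_norm ?zvar_ge0// (le_trans (zvar_le_spread _ rho0 (ltW r0)))//.
have -> : e = 2 * (e / 4) + e / 2 by field.
rewrite lerD//; first by rewrite ler_wpM2l// ltW// Hr.
rewrite mulrA -/K.
have Krho : K / rho <= 1 /\ K / rho <= e / 2.
  split; rewrite ler_pdivrMr// ?mul1r.
    by near: rho; apply: nbhs_pinfty_ge; exact: num_real.
  rewrite [leRHS]mulrC -(ler_pdivrMr _ _ e2).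
  by near: rho; apply: nbhs_pinfty_ge; exact: num_real.
case: Krho => h1 h2; have h0 : 0 <= K / rho by rewrite divr_ge0// ltW.
nra.
Unshelve. all: by end_near. Qed.

Lemma zmean_q_cvg0 delta : zmean rho delta ('X * (1 - 'X)) @[rho --> 0^'+] --> (0 : R).
Proof.
apply/cvgr0Pnorm_le => e e0.
have e2 : 0 < e / 2 by rewrite divr_gt0.
have [y y0 Hy] := Phi_small e2.
pose K : R := normal_peak 1.
have K0 : 0 < K by rewrite normal_peak_gt0 ?oner_eq0.
(* With this radius the interval around [delta] has mass at most [e / 2]. *)
pose eta := e / (4 * K).
have eta0 : 0 < eta by rewrite divr_gt0// mulr_gt0.
near=> rho.
have rho0 : 0 < rho by near: rho; exact: nbhs_right_gt.
rewrite ger0_norm ?(ltW (zmean_q_gt0 _ _))//.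
rewrite (le_trans (zmean_q_le _ rho0 (ltW eta0)))//.
have -> : e = K * (2 * eta) + e / 2 by rewrite /eta; field; rewrite gt_eqF.
rewrite lerD2l mulNr ltW// Hy// ler_pdivlMr// mulrC -ler_pdivlMr//.
by near: rho; apply: nbhs_right_le; rewrite divr_gt0.
Unshelve. all: by end_near. Qed.

Lemma zvar_cvg_norm_pinfty rho : 0 < rho ->
  zvar rho delta @[delta --> norm_pinfty_nbhs R] --> (0 : R).
Proof.
move=> rho0; apply/cvgr0Pnorm_le => e e0.
have [y y0 Hy] := Phi_small e0.
have r0 : 0 < Num.sqrt (rho ^+ 2 + 1) by rewrite sqrtr_gt0 ltr_wpDl ?sqr_ge0.
rewrite /norm_pinfty_nbhs /prop_near1 /nbhs/=.
have := nbhs_pinfty_ge (num_real (y * Num.sqrt (rho ^+ 2 + 1))).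
apply: filterS => r yr delta rd.
rewrite ger0_norm ?zvar_ge0// (le_trans (zvar_le_tail _ rho0))// ltW// Hy//.
by rewrite ler_pdivlMr// (le_trans yr)// ltW.
Qed.

End VarianceLimits.

Lemma rank_error_cvg0 (R : realType) (n : nat) (T : Type) (F : set_system T)
    {FF : Filter F} (N : T -> normal_sample R n) (k : nat) (h : T -> R) (C : R) :
  (\forall t \near F,
     `|ns_rank_prob (N t) k - beta_binomial_prob (N t) k| <= C * h t) ->
  h t @[t --> F] --> (0 : R) ->
  `|ns_rank_prob (N t) k - beta_binomial_prob (N t) k| @[t --> F] --> (0 : R).
Proof.
move=> Nh h0; apply: (@squeeze_cvgr _ _ _ _ (cst 0) (fun t => C * h t)).
- by apply: filterS Nh => t ->; rewrite normr_ge0.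
- exact: cvg_cst.
- by rewrite -[X in _ --> X](mulr0 C); apply: cvgM => //; exact: cvg_cst.
Qed.

Lemma sqrt_cvg0 (R : realType) (T : Type) (F : set_system T) {FF : Filter F} (f : T -> R) :
  f t @[t --> F] --> (0 : R) -> Num.sqrt (f t) @[t --> F] --> (0 : R).
Proof.
move=> f0; rewrite -[X in _ --> X]sqrtr0.
by apply: (cvg_comp f (@Num.sqrt R) f0); exact: sqrt_continuous.
Qed.

Theorem theorem3p1 (R : realType) (n : nat) (hn : (1 <= n)%N) :
  (forall (M M' : normal_sample R n) (k : nat),
     ns_rho M = ns_rho M' -> ns_delta M = ns_delta M' ->
     ns_rank_prob M k = ns_rank_prob M' k) /\
  forall M : R -> R -> normal_sample R n,
    (forall rho delta : R, 0 < rho ->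
       ns_rho (M rho delta) = rho /\ ns_delta (M rho delta) = delta) ->
  forall k : nat, (1 <= k <= n.+1)%N ->
  let err (rho delta : R) : R :=
    `|ns_rank_prob (M rho delta) k - beta_binomial_prob (M rho delta) k| in
  [/\ forall delta : R, err rho delta @[rho --> 0^'+] --> (0 : R),
      forall delta : R, err rho delta @[rho --> +oo] --> (0 : R),
      forall rho : R, 0 < rho ->
        err rho delta @[delta --> norm_pinfty_nbhs R] --> (0 : R)
    & forall c : R, c != 0 -> err rho (c * rho) @[rho --> +oo] --> (0 : R)].
Proof.
split=> [M M' k rhoE deltaE|M HM k kn err].
  have [kn|/negP kn] := boolP (1 <= k <= n.+1)%N.
    by rewrite (ns_rank_probE M kn) (ns_rank_probE M' kn) rhoE deltaE.
  have kn0 : (k == 0)%N || (n.+1 < k)%N.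
    by case: k kn => // k; rewrite /= => /negP; rewrite -ltnNge.
  by rewrite !ns_rank_prob0.
have errV rho delta : 0 < rho ->
    err rho delta <= 'C(n, k - 1)%:R * 4 * n%:R * Num.sqrt (zvar rho delta).
  move=> rho0; have := rank_prob_error_V (M rho delta) kn.
  by rewrite varZE -/(zvar _ _); have [-> ->] := HM rho delta rho0; rewrite !mulrA.
have err_pinfty (delta : R -> R) : err rho (delta rho) @[rho --> +oo] --> (0 : R).
  apply: (@rank_error_cvg0 _ _ _ _ _ _ _ (fun rho => Num.sqrt (zvar rho (delta rho)))).
    have := nbhs_pinfty_gt (num_real (0 : R)); apply: filterS => rho.
    exact: errV.
  by apply: sqrt_cvg0; exact: zvar_cvg_pinfty.
split=> [delta|delta|rho rho0|c _]; try exact: err_pinfty.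
- apply: (@rank_error_cvg0 _ _ _ _ _ _ _
    (fun rho => zmean rho delta ('X * (1 - 'X))) ('C(n, k - 1)%:R * 2 * n%:R)); last exact: zmean_q_cvg0.
  have := @nbhs_right_gt R 0; apply: filterS => rho rho0.
  have := rank_prob_error_q (M rho delta) hn kn.
  by have [-> ->] := HM rho delta rho0; rewrite !mulrA.
- apply: (@rank_error_cvg0 _ _ _ _ _ _ _ (fun delta => Num.sqrt (zvar rho delta))).
    by apply: nearW => delta; exact: errV.
  by apply: sqrt_cvg0; exact: zvar_cvg_norm_pinfty.
Qed.
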